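(* The equality \[\lim_{n\rightarrow\infty}\frac{u_n(132)}{C_n}=\frac12\] holds, where $C_n=\binom{2n}{n}/(n+1)$ is the $n$-th Catalan number.
   Context: An increasing subsequence of a permutation $p=p_1p_2\cdots p_n$ is a set of entries $p_{j_1}<p_{j_2}<\cdots<p_{j_k}$ with $j_1<j_2<\cdots<j_k$ (positions need not be consecutive). The permutation $p$ has a unique longest increasing subsequence (ULIS) if it has an increasing subsequence that is longer than all its other increasing subsequences. A permutation $p$ contains the pattern $q=q_1\cdots q_k$ if there are indices $i_1<\cdots<i_k$ such that $p_{i_r}<p_{i_s}$ if and only if $q_r<q_s$; otherwise $p$ avoids $q$. For a pattern $q$, $u_n(q)$ denotes the number of permutations of length $n$ that avoid $q$ and have a ULIS. *)

(* Defs.v *)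
From mathcomp Require Import all_boot all_order all_algebra all_fingroup.

Set Implicit Arguments.
Unset Strict Implicit.
Unset Printing Implicit Defensive.

(* A permutation p_1 ... p_n is an element p of 'S_n, with positions and values
   numbered from 0. *)

(* A subsequence is given by its set of positions. *)
Definition increasing_subseq (n : nat) (p : 'S_n) (A : {set 'I_n}) : bool :=
  [forall i in A, forall j in A, (i < j) ==> (p i < p j)].

Definition has_ulis (n : nat) (p : 'S_n) : bool :=
  [exists A : {set 'I_n}, increasing_subseq p A &&
    [forall B : {set 'I_n},
      (increasing_subseq p B && (B != A)) ==> (#|B| < #|A|)]].

Definition contains (n k : nat) (p : 'S_n) (q : 'S_k) : bool :=
  [exists f : {ffun 'I_k -> 'I_n},
    [forall r : 'I_k, forall s : 'I_k, (r < s) ==> (f r < f s)] &&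
    [forall r : 'I_k, forall s : 'I_k, (p (f r) < p (f s)) == (q r < q s)]].

Definition avoids (n k : nat) (p : 'S_n) (q : 'S_k) : bool :=
  ~~ contains p q.

Definition ulis_avoiders (n k : nat) (q : 'S_k) : nat :=
  #|[set p : 'S_n | avoids p q && has_ulis p]|.

Definition pattern132 : 'S_3 :=
  tperm (@Ordinal 3 1 isT) (@Ordinal 3 2 isT).

Lemma pattern132_one_line :
  [seq (val (pattern132 i)).+1 | i <- enum 'I_3] = [:: 1; 3; 2].
Proof.
by rewrite !enum_ordSl enum_ord0 /= !permE.
Qed.

Definition catalan (R : fieldType) (n : nat) : R :=
  ('C(2 * n, n)%:R / n.+1%:R)%R.

(* Main.v *)
Require Import Defs.
From mathcomp Require Import all_boot all_order all_algebra all_fingroup.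
From mathcomp Require Import all_classical all_reals all_analysis.
From mathcomp Require Import qpoly zify ring lra.
Import Order.TTheory GRing.Theory Num.Theory numFieldNormedType.Exports.
Set Implicit Arguments.
Unset Strict Implicit.
Unset Printing Implicit Defensive.

(** A permutation avoiding 132 has the form L n R where every entry of L exceeds
    every entry of R, and L, R avoid 132.  An increasing subsequence lives either
    in L n or in R, so the length of the longest one is
    max (lis L + 1, lis R), and it is unique exactly when the larger of the two
    sides is strictly larger and unique there.  This turns the generating
    functions A_h (longest length at most h) and E_h (unique longest
    subsequence, of length h) into
      A_(h+1) = 1 + x A_h A_(h+1)   and   E_(h+1) = x E_h A_h^2 ,
    which the substitution x = t / (1 + t)^2 solves:
      A_h = (1 + t) (1 - t^(h+1)) / (1 - t^(h+2)),
      E_h = t^h (1 - t)^2 / (1 - t^(h+1))^2 .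
    Summing over h gives t U = (1 - t)^2 sum_m sigma(m) t^m, with sigma the sum of
    divisors.  To smooth sigma, it is summed twice: with
    S(y) = sum_(m < y) (y - m) sigma(m),
      t^2 U = (1 - t)^4 sum_y S(y) t^y .
    The coefficient of x^n in a series f is the coefficient of t^n in
    (1 - t) (1 + t)^(2n-1) f, hence (ulis_avoiders_sum)
      u_n = sum_y S(y) c(n + 2 - y),
    where c(j) is the coefficient of t^j in (1 - t)^5 (1 + t)^(2n-1).

    The point is that S(y) = Z y^3 - y^2 / 4 + O(y^(3/2)) (riesz_sum_estimate).
    Against c, the cube contributes exactly 0, because it leads to the central
    coefficient of an antisymmetric polynomial (sum_cube_kernel); the square
    contributes exactly -2 C_n (sum_sqr_kernel).  The main term of u_n is thus
    C_n / 2, whatever Z is.  The error term is negligible because c is a central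
    binomial coefficient times a quintic polynomial in y, whose odd moments
    telescope (kernel_sqr_sum, kernel_sum). *)

(** * Words avoiding 132 *)

(** An entry a plays the role of 1 in an occurrence of 132 exactly when the later
    entries above a are not weakly increasing. *)
Fixpoint av132 (w : seq nat) : bool :=
  if w is a :: w' then pairwise leq [seq b <- w' | a < b] && av132 w' else true.

Lemma filter_ltn_nil M r : {in r, forall c, c <= M} -> [seq b <- r | M < b] = [::].
Proof.
move=> rM; rewrite (eq_in_filter (a2 := pred0)) ?filter_pred0 // => c /rM.
by rewrite ltnNge => ->.
Qed.

(** A maximum with larger entries on its left than on its right cannot take part
    in a 132, and no 132 can straddle it, so avoidance splits. *)
Lemma av132_cat_max l M r :
    {in l, forall a, a < M} -> {in r, forall c, c < M} ->
    {in l & r, forall a c, c < a} ->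
  av132 (l ++ M :: r) = av132 l && av132 r.
Proof.
move=> lM rM; elim: l lM => [|a l IHl] lM rl /=.
  by rewrite filter_ltn_nil // => c /rM /ltnW.
rewrite filter_cat /= lM ?mem_head // IHl; last 2 first.
- by move=> b lb; apply: lM; rewrite inE lb orbT.
- by move=> b c lb; apply: rl; rewrite inE lb orbT.
rewrite (filter_ltn_nil (r := r)); last by move=> c rc; rewrite ltnW // rl // mem_head.
rewrite pairwise_cat /= !andbT andbA; congr (_ && _ && _).
rewrite andb_idl // => _.
apply/allrelP => x y; rewrite mem_filter inE => /andP[_ lx] /eqP ->.
by rewrite ltnW // lM // inE lx orbT.
Qed.

(** Entries a before and c after the maximum M with a < c would form the
    occurrence a M c of 132. *)
Lemma av132_max_split l M r :
    {in l ++ r, forall a, a < M} -> uniq (l ++ r) -> av132 (l ++ M :: r) ->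
  {in l & r, forall a c, c < a}.
Proof.
elim: l => [//|a l IHl] lM /= /andP[a_notin Ulr] /andP[Pa av] x c.
rewrite inE => /orP[/eqP -> rc|lx rc]; last first.
  by apply: IHl => // y ly; apply: lM; rewrite inE ly orbT.
rewrite ltnNge leq_eqVlt negb_or; apply/andP; split.
  by apply: contraNneq a_notin => ->; rewrite mem_cat rc orbT.
apply/negP => lt_ac.
move: Pa; rewrite filter_cat /= (lM a) ?mem_head //.
rewrite pairwise_cat /= => /and3P[_ _ /andP[/allP ge_M _]].
have: c \in [seq b <- r | a < b] by rewrite mem_filter lt_ac.
by move/ge_M; rewrite leqNgt lM // inE mem_cat rc !orbT.
Qed.

Lemma av132_shift k l : av132 (map (addn k) l) = av132 l.
Proof.
elim: l => //= a l ->; congr (_ && _).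
rewrite filter_map pairwise_map; under eq_filter do rewrite /= ltn_add2l.
by apply: eq_pairwise => x y; rewrite /= leq_add2l.
Qed.

Definition avoiders132 n := [seq w <- permutations (iota 0 n) | av132 w].

Lemma mem_avoiders132 n w : (w \in avoiders132 n) = perm_eq w (iota 0 n) && av132 w.
Proof. by rewrite mem_filter mem_permutations andbC. Qed.

Lemma size_avoiders132 n w : w \in avoiders132 n -> size w = n.
Proof. by rewrite mem_avoiders132 => /andP[/perm_size ->]; rewrite size_iota. Qed.

Lemma avoiders132_lt n w : w \in avoiders132 n -> {in w, forall a, a < n}.
Proof.
by rewrite mem_avoiders132 => /andP[/perm_mem wE _] a; rewrite wE mem_iota.
Qed.

Lemma avoiders132_uniq n : uniq (avoiders132 n).
Proof. by rewrite filter_uniq ?permutations_uniq. Qed.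

(** The word l n r described above, built from permutation words l and r: the
    entries of l are shifted above those of r. *)
Definition glue (l r : seq nat) : seq nat :=
  map (addn (size r)) l ++ (size l + size r) :: r.

Lemma mem_glue_left i j l r : l \in avoiders132 i -> r \in avoiders132 j ->
  {in map (addn (size r)) l, forall a, a < size l + size r}.
Proof.
move=> li rj _ /mapP[b lb ->]; rewrite addnC ltn_add2r.
by rewrite (size_avoiders132 li) (avoiders132_lt li).
Qed.

Lemma mem_glue_lr j l r : r \in avoiders132 j ->
  {in map (addn (size r)) l & r, forall a c, c < a}.
Proof.
move=> rj _ c /mapP[b lb ->] rc.
by rewrite (leq_trans (avoiders132_lt rj rc)) // (size_avoiders132 rj) leq_addr.
Qed.

Lemma mem_glue_right (l : seq nat) j r : r \in avoiders132 j -> {in r, forall a, a < size l + size r}.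
Proof.
move=> rj c rc; apply: leq_trans (avoiders132_lt rj rc) _.
by rewrite (size_avoiders132 rj) leq_addl.
Qed.

Lemma perm_glue l r :
  perm_eq l (iota 0 (size l)) -> perm_eq r (iota 0 (size r)) ->
  perm_eq (glue l r) (iota 0 (size l + size r).+1).
Proof.
move=> Pl Pr; rewrite /glue -cat1s perm_catCA cat1s.
rewrite -[in X in perm_eq _ X]addn1 iotaD /= add0n perm_sym perm_catC cat1s.
rewrite perm_cons addnC iotaD perm_catC add0n; apply: perm_cat.
  by rewrite -[X in iota X _]addn0 iotaDl perm_map // perm_sym.
by rewrite perm_sym.
Qed.

Lemma glue_avoiders132 i j l r : l \in avoiders132 i -> r \in avoiders132 j -> glue l r \in avoiders132 (i + j).+1.
Proof.
move=> li rj; rewrite mem_avoiders132 -{1}(size_avoiders132 li) -{1}(size_avoiders132 rj).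
rewrite /glue (av132_cat_max (mem_glue_left li rj) (mem_glue_right l rj)
  (mem_glue_lr rj)) av132_shift.
have := li; have := rj; rewrite !mem_avoiders132 => /andP[Pr ->] /andP[Pl ->] /=.
by rewrite andbT perm_glue // ?(size_avoiders132 li) ?(size_avoiders132 rj).
Qed.

Lemma glue_inj i j i' j' l r l' r' :
    l \in avoiders132 i -> r \in avoiders132 j -> l' \in avoiders132 i' -> r' \in avoiders132 j' ->
  glue l r = glue l' r' -> l = l' /\ r = r'.
Proof.
move=> li rj li' rj' E.
have sE : size l + size r = size l' + size r'.
  by have := congr1 size E; rewrite !size_cat !size_map /= !addnS => -[].
have indexE a b x y : a \in avoiders132 x -> b \in avoiders132 y ->
    index (size a + size b) (glue a b) = size a.
  move=> ax bY; rewrite index_cat /= eqxx addn0 size_map ifN //.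
  by apply/negP => /(mem_glue_left ax bY); rewrite ltnn.
have sl : size l = size l' by rewrite -(indexE _ _ _ _ li rj) E sE (indexE _ _ _ _ li' rj').
have sr : size r = size r' by apply/eqP; rewrite -(eqn_add2l (size l)) sE sl.
move/eqP: E; rewrite /glue eqseq_cat ?size_map // sr => /andP[/eqP El /eqP[_ ->]].
by split=> //; apply: inj_map El => x y /addnI.
Qed.

Lemma perm_iota_split l r n : perm_eq (l ++ r) (iota 0 n) ->
    {in l & r, forall a c, c < a} ->
  perm_eq r (iota 0 (size r)) /\ perm_eq l (iota (size r) (size l)).
Proof.
move=> P lr.
have nE : n = size r + size l by move/perm_size: P; rewrite size_cat size_iota addnC.
have: sort leq r ++ sort leq l = iota 0 n.
  apply: (sorted_eq leq_trans anti_leq); last 2 first.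
  - exact: iota_sorted.
  - by apply: perm_trans P; rewrite perm_catC perm_cat ?perm_sort.
  rewrite (sorted_pairwise leq_trans) pairwise_cat -!(sorted_pairwise leq_trans).
  rewrite !(sort_sorted leq_total) !andbT; apply/allrelP => x y.
  by rewrite !mem_sort => rx ly; rewrite ltnW // lr.
rewrite nE iotaD add0n => /eqP; rewrite eqseq_cat ?size_sort ?size_iota //.
by move=> /andP[/eqP <- /eqP <-]; split; rewrite perm_sym perm_sort.
Qed.

(** The part r after the maximum consists of the smallest values, so it is already
    a permutation word, and the part before it becomes one after a shift. *)
Lemma glue_split n w : w \in avoiders132 n.+1 ->
  exists l r, [/\ w = glue l r, l \in avoiders132 (size l), r \in avoiders132 (size r)
    & size l + size r = n].
Proof.
rewrite mem_avoiders132 => /andP[Pw avw].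
have wn : n \in w by rewrite (perm_mem Pw) mem_iota ltnSn.
have Uw : uniq w by rewrite (perm_uniq Pw) iota_uniq.
case/splitPr: wn Pw avw Uw => l' r Pw avw Uw.
have {}Pw : perm_eq (l' ++ r) (iota 0 n).
  move: Pw; rewrite -cat1s perm_catCA cat1s -addn1 iotaD add0n /= perm_sym.
  by rewrite perm_catC cat1s perm_cons perm_sym.
have lrn : {in l' ++ r, forall a, a < n} by move=> a; rewrite (perm_mem Pw) mem_iota.
have Ulr : uniq (l' ++ r) by rewrite (perm_uniq Pw) iota_uniq.
have lr := av132_max_split lrn Ulr avw.
have [Pr Pl] := perm_iota_split Pw lr.
set l := map (subn^~ (size r)) l'.
have lE : map (addn (size r)) l = l'.
  rewrite /l -map_comp -[RHS]map_id; apply/eq_in_map => a.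
  by rewrite (perm_mem Pl) mem_iota => /andP[ra _] /=; rewrite subnKC.
have sl : size l = size l' by rewrite size_map.
have nE : size l + size r = n.
  by move/perm_size: Pw; rewrite size_cat size_iota sl.
move: avw; rewrite av132_cat_max //; last 2 first.
- by move=> a la; rewrite lrn // mem_cat la.
- by move=> a ra; rewrite lrn // mem_cat ra orbT.
rewrite -lE av132_shift => /andP[avl avr].
exists l, r; split=> //; first by rewrite /glue lE nE.
- rewrite mem_avoiders132 avl andbT; apply/(perm_map_inj (@addnI (size r))).
  by rewrite lE -iotaDl addn0 sl.
- by rewrite mem_avoiders132 Pr.
Qed.

(** Triples (i, l, r) flattened to pairs: i is redundant, being the size of l, but
    it makes the convolution structure visible. *)
Definition splits n : seq (seq nat * seq nat) :=
  [seq p | i <- iota 0 n.+1, p <- [seq (l, r) | l <- avoiders132 i, r <- avoiders132 (n - i)]].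

Lemma mem_splits n l r : (l, r) \in splits n ->
  exists2 i, i <= n & l \in avoiders132 i /\ r \in avoiders132 (n - i).
Proof.
move=> /allpairsPdep[i [p [+ + E]]]; rewrite -{p}E mem_iota => lin.
by case/allpairsP => -[l' r'] [/= ? ? [-> ->]]; exists i.
Qed.

Lemma avoiders132_rec n : perm_eq (avoiders132 n.+1) [seq glue p.1 p.2 | p <- splits n].
Proof.
apply: uniq_perm; first exact: avoiders132_uniq.
  rewrite map_inj_in_uniq.
    apply: allpairs_uniq_dep => [|i _|]; first exact: iota_uniq.
      by apply: allpairs_uniq; rewrite ?avoiders132_uniq // => -[? ?] [? ?] _ _ /= [-> ->].
    move=> _ _ /allpairsPdep[i [p [_ + ->]]] /allpairsPdep[i' [p' [_ + ->]]] /=.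
    move=> /allpairsP[[l r] [/= li _ ->]] /allpairsP[[l' r'] [/= li' _ ->]] [El Er].
    by rewrite El Er -(size_avoiders132 li) El (size_avoiders132 li').
  move=> [l r] [l' r'] /mem_splits[i _ [li ri]] /mem_splits[j _ [lj rj]] /= E.
  by have [-> ->] := glue_inj li ri lj rj E.
move=> w; apply/idP/mapP => [/glue_split[l [r [-> avl avr <-]]]|].
  exists (l, r) => //; apply/allpairsPdep; exists (size l), (l, r).
  rewrite mem_iota ltnS leq_addr; split=> //; apply/allpairsP.
  by exists (l, r); rewrite addKn.
move=> [[l r] /mem_splits[i lein [li ri]] ->] /=.
by rewrite -(subnKC lein); apply: glue_avoiders132.
Qed.

Lemma count_avoiders132_rec (P : pred (seq nat)) n :
  count P (avoiders132 n.+1) =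
  \sum_(i < n.+1) \sum_(l <- avoiders132 i) \sum_(r <- avoiders132 (n - i)) P (glue l r).
Proof.
rewrite (seq.permP (avoiders132_rec n)) count_map -sum1_count big_mkcond /=.
rewrite /splits big_allpairs_dep /= -(big_mkord xpredT (fun i =>
  \sum_(l <- avoiders132 i) \sum_(r <- avoiders132 (n - i)) (P (glue l r) : nat))).
rewrite /index_iota subn0; apply: eq_bigr => i _.
by rewrite big_allpairs; do 2!apply: eq_bigr => ? _; case: ifP.
Qed.

(** * Unique longest increasing subsequences of words *)

(** A mask selects positions, so that distinct masks are distinct subsequences, as
    in the definition of a unique longest increasing subsequence. *)
Definition inc_mask (m : bitseq) (w : seq nat) : bool :=
  (size m == size w) && sorted ltn (mask m w).

Definition lis_le (w : seq nat) (h : nat) : Prop :=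
  forall m, inc_mask m w -> count id m <= h.

Definition unique_lis (w : seq nat) (h : nat) : Prop :=
  exists m, [/\ inc_mask m w, count id m = h
    & forall m', inc_mask m' w -> m' <> m -> count id m' < h].

Lemma count_nseq_false n : count id (nseq n false) = 0.
Proof. by rewrite count_nseq. Qed.

Lemma inc_mask_nil w : inc_mask (nseq (size w) false) w.
Proof. by rewrite /inc_mask size_nseq eqxx mask_false. Qed.

Lemma inc_mask_shift m k w : inc_mask m (map (addn k) w) = inc_mask m w.
Proof.
rewrite /inc_mask size_map -map_mask sorted_map.
by congr (_ && _); apply: eq_sorted => x y; rewrite /= ltn_add2l.
Qed.

Lemma bitseq_false (m : bitseq) : ~~ has id m -> m = nseq (size m) false.
Proof.
move=> m0; apply/all_pred1P; apply/allP => b bm; rewrite /= eqbF_neg.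
by apply: contra m0 => bT; apply/hasP; exists b.
Qed.

Lemma mask_has_mem (T : eqType) (m : bitseq) (s : seq T) :
  size m = size s -> has id m -> exists2 x, x \in mask m s & x \in s.
Proof.
move=> ms; rewrite has_count -(size_mask ms) => s0.
case E: (mask m s) s0 => [//|x u] _; exists x; first exact: mem_head.
by apply: (@mem_mask _ _ m); rewrite E mem_head.
Qed.

Section Glue.
Variables (i j : nat) (l r : seq nat).
Hypotheses (li : l \in avoiders132 i) (rj : r \in avoiders132 j).

Lemma inc_mask_glue_left m b : inc_mask m l -> inc_mask (m ++ b :: nseq (size r) false) (glue l r).
Proof.
rewrite -(inc_mask_shift m (size r)) /inc_mask size_map => /andP[/eqP sm so].
rewrite !size_cat /= size_nseq size_map sm eqxx /=.
rewrite mask_cat ?size_map //= mask_false.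
case: b => /=; last by rewrite cats0.
move: so; rewrite !(sorted_pairwise ltn_trans) pairwise_cat /= => ->.
rewrite !andbT; apply/allrelP => x y /mem_mask lx.
by rewrite inE => /eqP ->; apply: (mem_glue_left li rj).
Qed.

Lemma inc_mask_glue_right m : inc_mask m r -> inc_mask (nseq (size l) false ++ false :: m) (glue l r).
Proof.
rewrite /inc_mask => /andP[/eqP sm so].
rewrite !size_cat /= size_nseq size_map sm eqxx /=.
by rewrite mask_cat ?size_nseq ?size_map //= mask_false.
Qed.

(** An entry of the right part and an earlier selected entry, which is larger,
    cannot both belong to an increasing subsequence. *)
Lemma inc_mask_glueP m : inc_mask m (glue l r) ->
  (exists m1 b, inc_mask m1 l /\ m = m1 ++ b :: nseq (size r) false) \/
  (exists2 m2, inc_mask m2 r & m = nseq (size l) false ++ false :: m2).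
Proof.
rewrite /inc_mask size_cat size_map /= => /andP[/eqP sm].
have sl : size (take (size l) m) = size l by rewrite size_takel // sm leq_addr.
rewrite -(cat_take_drop (size l) m) in sm *; move: sm.
rewrite size_cat sl => /addnI; move: sl.
set m1 := take _ m; case: (drop _ m) => [//|b m2] sl [sr].
rewrite mask_cat ?size_map // mask_cons => so.
have [r_sel|/bitseq_false r0] := boolP (has id m2); last first.
  left; exists m1, b; rewrite r0 sr; split=> //.
  move: so => /cat_sorted2[so _].
  rewrite -/(inc_mask _ _) -(inc_mask_shift m1 (size r)) /inc_mask size_map sl eqxx /=.
  exact: so.
right; exists m2.
  rewrite sr eqxx /=; move: so; rewrite catA => so.
  by have := subseq_sorted ltn_trans (suffix_subseq _ _) so.
have [x xr rx] := mask_has_mem sr r_sel.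
move: so; case: b => /=.
  move=> /cat_sorted2[_]; rewrite /= (path_sortedE ltn_trans).
  move=> /andP[/allP /(_ x xr)].
  by rewrite ltnNge ltnW ?(mem_glue_right _ rj rx).
rewrite (sorted_pairwise ltn_trans) pairwise_cat.
move=> /andP[/allrelP lr _]; congr (_ ++ _); rewrite -sl; apply: bitseq_false.
apply/negP => l_sel.
have [||a am al] := @mask_has_mem _ m1 (map (addn (size r)) l).
- by rewrite size_map.
- exact: l_sel.
have := lr a x am xr.
by rewrite /= ltnNge ltnW // (mem_glue_lr (l := l) rj).
Qed.

Lemma lis_le_glue0 : ~ lis_le (glue l r) 0.
Proof.
by move=> /(_ _ (inc_mask_glue_left true (inc_mask_nil l))); rewrite count_cat /= addnCA.
Qed.

Lemma lis_le_glueS h : lis_le (glue l r) h.+1 <-> lis_le l h /\ lis_le r h.+1.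
Proof.
split=> [B|[Bl Br] m].
  split=> m im.
    have := B _ (inc_mask_glue_left true im).
    by rewrite count_cat /= count_nseq_false addn0 addn1.
  by have := B _ (inc_mask_glue_right im); rewrite count_cat /= count_nseq_false.
case/inc_mask_glueP => [[m1 [b [/Bl m1h ->]]]|[m2 /Br m2h ->]].
  rewrite count_cat /= count_nseq_false addn0 -addn1 leq_add //; exact: leq_b1.
by rewrite count_cat /= count_nseq_false.
Qed.

Lemma unique_lis_glue0 : ~ unique_lis (glue l r) 0.
Proof.
move=> [m [im m0 mmax]].
have /mmax := inc_mask_glue_left true (inc_mask_nil l); rewrite ltn0 => /(_ _)/negP.
suff: nseq (size l) false ++ true :: nseq (size r) false <> m by move=> /[swap] H /H.
by move=> mE; move: m0; rewrite -mE count_cat /= addnCA.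
Qed.

(** The unique longest subsequence either passes through the maximum entry, in
    which case the right part must stay strictly below, or lies in the right part,
    in which case the left part completed by the maximum must stay strictly
    below. *)
Lemma unique_lis_glueS h : unique_lis (glue l r) h.+1 <->
  (unique_lis l h /\ lis_le r h) \/
  (unique_lis r h.+1 /\ exists2 k, h = k.+1 & lis_le l k).
Proof.
split.
  move=> [m [im mh mmax]].
  case: (inc_mask_glueP im) => [[m1 [b [im1 mE]]]|[m2 im2 mE]].
    have bT : b = true.
      case: b mE => // mE.
      have /mmax : inc_mask (m1 ++ true :: nseq (size r) false) (glue l r).
        exact: inc_mask_glue_left.
      have neq : m1 ++ true :: nseq (size r) false <> m.
        by rewrite mE => /eqP; rewrite eqseq_cat // eqxx.
      move=> /(_ neq); rewrite -mh mE !count_cat /= !count_nseq_false.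
      by rewrite ltn_add2l.
    subst b; left; split.
      exists m1; split=> //.
        by move: mh; rewrite mE count_cat /= count_nseq_false addn0 addn1 => -[].
      move=> m' im' m'm1.
      have /mmax := inc_mask_glue_left true im'.
      rewrite count_cat /= count_nseq_false addn0 addn1 ltnS; apply.
      rewrite mE => /eqP; rewrite eqseq_cat; first by move=> /andP[/eqP].
      by move: im' im1 => /andP[/eqP -> _] /andP[/eqP -> _].
    move=> m2 im2.
    have /mmax := inc_mask_glue_right im2.
    rewrite count_cat /= count_nseq_false ltnS; apply.
    rewrite mE => /eqP; rewrite eqseq_cat; first by rewrite eqseq_cons andbF.
    by move: im1 => /andP[/eqP -> _]; rewrite size_nseq.
  right; split.
    exists m2; split=> //.
      by move: mh; rewrite mE count_cat /= count_nseq_false.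
    move=> m' im' m'm2.
    have /mmax := inc_mask_glue_right im'.
    rewrite count_cat /= count_nseq_false; apply.
    by rewrite mE => /eqP; rewrite eqseq_cat // eqxx eqseq_cons /= => /eqP.
  have lh m1 : inc_mask m1 l -> count id m1 < h.
    move=> im1; have /mmax := inc_mask_glue_left true im1.
    rewrite count_cat /= count_nseq_false addn0 addn1 ltnS; apply.
    rewrite mE => /eqP; rewrite eqseq_cat; first by rewrite eqseq_cons andbF.
    by move: im1 => /andP[/eqP -> _]; rewrite size_nseq.
  case: h lh {mh mmax} => [|k] lh; first by have := lh _ (inc_mask_nil l).
  by exists k.
case=> [[[m1 [im1 m1h m1max]] Br]|[[m2 [im2 m2h m2max]] [k hE Bl]]].
  exists (m1 ++ true :: nseq (size r) false); split; first exact: inc_mask_glue_left.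
    by rewrite count_cat /= count_nseq_false addn0 addn1 m1h.
  move=> m' /inc_mask_glueP[[m1' [b [im1' ->]]] neq|[m2 im2 ->] _]; last first.
    by rewrite count_cat /= count_nseq_false ltnS Br.
  rewrite count_cat /= count_nseq_false addn0.
  have [m1E|/eqP m1N] := eqVneq m1' m1.
    by case: b neq => [|_]; rewrite m1E // addn0 m1h.
  by case: b {neq}; rewrite ?addn1 ?addn0 ?ltnS ?m1max // ltnW // m1max.
exists (nseq (size l) false ++ false :: m2); split; first exact: inc_mask_glue_right.
  by rewrite count_cat /= count_nseq_false.
move=> m' /inc_mask_glueP[[m1 [b [im1 ->]]] _|[m2' im2' ->] neq]; last first.
  by rewrite count_cat /= count_nseq_false; apply: m2max => // E; rewrite E in neq.
rewrite count_cat /= count_nseq_false addn0 hE !ltnS.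
by rewrite -addn1 leq_add ?leq_b1 ?Bl.
Qed.

End Glue.

Definition lis_count (h n : nat) : nat := count (fun w => `[< lis_le w h >]) (avoiders132 n).

Definition ulis_count (h n : nat) : nat := count (fun w => `[< unique_lis w h >]) (avoiders132 n).

Lemma avoiders132_0 : avoiders132 0 = [:: [::]].
Proof. by []. Qed.

Lemma inc_mask_empty m : inc_mask m [::] -> m = [::].
Proof. by rewrite /inc_mask => /andP[/nilP]. Qed.

Lemma lis_count0 h : lis_count h 0 = 1.
Proof.
by rewrite /lis_count avoiders132_0 /=; case: asboolP => // -[] m /inc_mask_empty ->.
Qed.

Lemma ulis_count0 h : ulis_count h 0 = (h == 0).
Proof.
rewrite /ulis_count avoiders132_0 /= addn0; congr nat_of_bool; apply/asboolP/eqP.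
  by move=> [m [/inc_mask_empty -> <-]].
by move=> ->; exists [::]; split=> // m /inc_mask_empty ->.
Qed.

Lemma sum_count_avoiders132 (P Q : pred (seq nat)) i j :
  \sum_(l <- avoiders132 i) \sum_(r <- avoiders132 j) (P l && Q r : nat) =
  count P (avoiders132 i) * count Q (avoiders132 j).
Proof.
rewrite -!sum1_count !(big_mkcond P) !(big_mkcond Q) /= big_distrl /=.
apply: eq_bigr => l _; rewrite big_distrr /=; apply: eq_bigr => r _.
by case: (P l); case: (Q r).
Qed.

Lemma lis_count_0S n : lis_count 0 n.+1 = 0.
Proof.
rewrite /lis_count count_avoiders132_rec big1 // => i _.
rewrite big_seq big1 // => l li; rewrite big_seq big1 // => r ri.
by case: asboolP => // /(lis_le_glue0 li ri).
Qed.

Lemma lis_count_SS h n :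
  lis_count h.+1 n.+1 = \sum_(i < n.+1) lis_count h i * lis_count h.+1 (n - i).
Proof.
rewrite {1}/lis_count count_avoiders132_rec; apply: eq_bigr => i _.
rewrite -sum_count_avoiders132; apply: eq_big_seq => l li; apply: eq_big_seq => r ri.
rewrite -asbool_and; congr (nat_of_bool _).
exact/asbool_equiv_eq/(lis_le_glueS li ri).
Qed.

Lemma ulis_count_0S n : ulis_count 0 n.+1 = 0.
Proof.
rewrite /ulis_count count_avoiders132_rec big1 // => i _.
rewrite big_seq big1 // => l li; rewrite big_seq big1 // => r ri.
by case: asboolP => // /(unique_lis_glue0 li ri).
Qed.

(** For length 1 the second alternative of unique_lis_glueS is void: the maximum
    entry alone already has length 1. *)
Lemma ulis_count_1S n :
  ulis_count 1 n.+1 = \sum_(i < n.+1) ulis_count 0 i * lis_count 0 (n - i).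
Proof.
rewrite {1}/ulis_count count_avoiders132_rec; apply: eq_bigr => i _.
rewrite -sum_count_avoiders132; apply: eq_big_seq => l li; apply: eq_big_seq => r ri.
rewrite -asbool_and; congr (nat_of_bool _).
apply: asbool_equiv_eq; split=> [/(unique_lis_glueS li ri)[//|[_ []]]//|?].
by apply/(unique_lis_glueS li ri); left.
Qed.

Lemma unique_lis_le w h : unique_lis w h -> lis_le w h.
Proof.
move=> [m [im mh mmax]] m' /mmax mm'.
by have [->|/eqP/mm'/ltnW//] := eqVneq m' m; rewrite mh.
Qed.

Lemma ulis_count_SS h n :
  ulis_count h.+2 n.+1 =
    \sum_(i < n.+1) (ulis_count h.+1 i * lis_count h.+1 (n - i)
                     + lis_count h i * ulis_count h.+2 (n - i)).
Proof.
rewrite {1}/ulis_count count_avoiders132_rec; apply: eq_bigr => i _.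
rewrite -!sum_count_avoiders132 -big_split; apply: eq_big_seq => l li.
rewrite -big_split; apply: eq_big_seq => r ri /=.
rewrite -!asbool_and; case: asboolP => [/(unique_lis_glueS li ri)|noU].
  case=> [[Ul Br]|[Ur [_ [<-] Bl]]].
    rewrite asboolT // asboolF // => -[Bl _].
    by case: Ul => m [im mh _]; have := Bl _ im; rewrite mh ltnn.
  rewrite asboolF ?asboolT // => -[_ Br].
  by case: Ur => m [im mh _]; have := Br _ im; rewrite mh ltnn.
rewrite !asboolF // => -[X Y]; apply: noU; apply/(unique_lis_glueS li ri).
  by right; split=> //; exists h.
by left.
Qed.

(** * From permutations to words *)

Section Words.
Variable n : nat.
Implicit Types (p : 'S_n) (A : {set 'I_n}).

Definition word p : seq nat := [seq val (p i) | i <- enum 'I_n].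

Lemma size_word p : size (word p) = n.
Proof. by rewrite size_map size_enum_ord. Qed.

Lemma nth_word p (i : 'I_n) : nth 0 (word p) i = p i.
Proof. by rewrite (nth_map i) ?size_enum_ord // nth_ord_enum. Qed.

Lemma word_inj : injective word.
Proof.
by move=> p q E; apply/permP => i; apply: val_inj; rewrite /= -!nth_word E.
Qed.

Lemma word_perm p : perm_eq (word p) (iota 0 n).
Proof.
rewrite -val_enum_ord /word map_comp; apply: perm_map.
apply: uniq_perm; rewrite ?(map_inj_uniq perm_inj) ?enum_uniq // => i.
rewrite mem_enum inE; apply/mapP; exists (p^-1%g i); rewrite ?mem_enum //.
by rewrite permKV.
Qed.

Lemma word_surj w : perm_eq w (iota 0 n) -> exists p, w = word p.
Proof.
move=> Pw.
have sw : size w = n by rewrite (perm_size Pw) size_iota.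
have wn (i : 'I_n) : nth 0 w i < n.
  by have := mem_nth 0 (_ : i < size w); rewrite sw ltn_ord (perm_mem Pw) mem_iota; apply.
have f_inj : injective (fun i => Ordinal (wn i)).
  move=> i j [] /eqP; rewrite nth_uniq ?sw // ?(perm_uniq Pw) ?iota_uniq //.
  by move=> /eqP/val_inj.
exists (perm f_inj); apply: (@eq_from_nth _ 0); rewrite ?size_word // sw => i lt_in.
by rewrite -[i]/(val (Ordinal lt_in)) nth_word permE.
Qed.

Lemma card_word (P : pred (seq nat)) :
  #|[set p | P (word p)]| = count P (permutations (iota 0 n)).
Proof.
have: perm_eq [seq word p | p <- enum 'S_n] (permutations (iota 0 n)).
  apply: uniq_perm; rewrite ?permutations_uniq ?(map_inj_uniq word_inj) ?enum_uniq //.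
  move=> w; rewrite mem_permutations; apply/mapP/idP => [[p _ ->]|/word_surj[p ->]].
    exact: word_perm.
  by exists p; rewrite ?mem_enum.
move/seq.permP => <-; rewrite count_map cardsE cardE -size_filter.
by rewrite {1}/enum_mem -enumT.
Qed.

Lemma pairwise_ordP (r : rel 'I_n) (s : seq 'I_n) :
    pairwise (fun i j : 'I_n => i < j) s ->
  reflect {in s &, forall i j : 'I_n, i < j -> r i j} (pairwise r s).
Proof.
elim: s => [|a s IHs] /=; first by left.
move=> /andP[/allP a_lt Ps]; apply: (iffP andP) => [[/allP ra /(IHs Ps) rs] i j|rs].
  rewrite !inE => /orP[/eqP ->|si] /orP[/eqP ->|sj]; rewrite ?ltnn //.
  - by move=> _; apply: ra.
  - by rewrite ltnNge ltnW //; apply: a_lt.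
  - exact: rs.
split; first by apply/allP => i si; apply: rs; rewrite ?mem_head ?inE ?si ?orbT ?a_lt.
by apply/(IHs Ps) => i j si sj; apply: rs; rewrite inE ?si ?sj orbT.
Qed.

Lemma pairwise_enum : pairwise (fun i j : 'I_n => i < j) (enum 'I_n).
Proof.
rewrite -(pairwise_map (val : 'I_n -> nat) ltn) val_enum_ord.
by rewrite -(sorted_pairwise ltn_trans) iota_ltn_sorted.
Qed.

Definition mask_of_set A : bitseq := [seq i \in A | i <- enum 'I_n].

Lemma mask_of_set_inj : injective mask_of_set.
Proof.
move=> A B /eq_in_map E; apply/setP => i; apply: E; by rewrite mem_enum.
Qed.

Lemma mask_of_set_surj m : size m = n -> exists A, m = mask_of_set A.
Proof.
move=> sm; exists [set i : 'I_n | nth false m i].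
apply: (@eq_from_nth _ false) => [|i]; first by rewrite size_map size_enum_ord.
rewrite sm => lt_in; rewrite /mask_of_set.
rewrite (nth_map (Ordinal lt_in)) ?size_enum_ord //.
by rewrite (nth_ord_enum (Ordinal lt_in) (Ordinal lt_in)) inE.
Qed.

Lemma count_mask_of_set A : count id (mask_of_set A) = #|A|.
Proof. by rewrite count_map -sum1_count big_enum_cond -sum1_card; apply: eq_bigl. Qed.

Lemma inc_mask_of_set p A : inc_mask (mask_of_set A) (word p) = increasing_subseq p A.
Proof.
rewrite /inc_mask size_word size_map size_enum_ord eqxx /=.
rewrite /word -map_mask -filter_mask (sorted_pairwise ltn_trans) pairwise_map.
have s_pw : pairwise (fun i j : 'I_n => i < j) [seq i <- enum 'I_n | i \in A].
  exact: subseq_pairwise (filter_subseq _ _) pairwise_enum.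
apply/(pairwise_ordP _ s_pw)/forall_inP => H.
  move=> i iA; apply/forall_inP => j jA; apply/implyP.
  by apply: H; rewrite mem_filter ?iA ?jA mem_enum.
move=> i j; rewrite !mem_filter => /andP[iA _] /andP[jA _].
by move/forall_inP: (H i iA) => /(_ j jA)/implyP.
Qed.

Lemma has_ulisP p : has_ulis p <-> exists h, unique_lis (word p) h.
Proof.
split=> [/existsP[A /andP[incA /forallP Amax]]|[h [m [im mh mmax]]]].
  exists #|A|, (mask_of_set A); rewrite inc_mask_of_set count_mask_of_set; split=> // m im mA.
  have [B mE] : exists B, m = mask_of_set B.
    by apply: mask_of_set_surj; move: im => /andP[/eqP ->]; rewrite size_word.
  move: im mA; rewrite mE inc_mask_of_set count_mask_of_set => im BA.
  by apply: (implyP (Amax B)); rewrite im; apply/eqP => E; apply: BA; rewrite E.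
have [A mE] : exists B, m = mask_of_set B.
  by apply: mask_of_set_surj; move: im => /andP[/eqP ->]; rewrite size_word.
apply/existsP; exists A; rewrite -inc_mask_of_set -mE im /=.
apply/forallP => B; apply/implyP => /andP[incB BA].
rewrite -!count_mask_of_set -mE mh; apply: mmax; first by rewrite inc_mask_of_set.
by rewrite mE => /mask_of_set_inj/eqP; apply/negP.
Qed.

(** Three positions i < j < k form a 132 when the value at k lies strictly between
    those at i and j. *)
Lemma av132P (f : 'I_n -> nat) (s : seq 'I_n) :
    pairwise (fun i j : 'I_n => i < j) s ->
  reflect {in s & &, forall i j k : 'I_n, i < j -> j < k -> f i < f k -> f j <= f k}
    (av132 (map f s)).
Proof.
elim: s => [|a s IHs] /=; first by left.
move=> /andP[/allP a_lt Ps].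
have Pf : pairwise (fun i j : 'I_n => i < j) [seq b <- s | f a < f b].
  exact: subseq_pairwise (filter_subseq _ _) Ps.
rewrite filter_map pairwise_map.
apply: (iffP andP) => [[/(pairwise_ordP _ Pf) ra /(IHs Ps) rs] i j k|rs].
  have a_min x : x \in a :: s -> a <= x by rewrite inE => /orP[/eqP ->//|/a_lt/ltnW].
  have in_s x y : x \in a :: s -> y \in a :: s -> x < y -> y \in s.
    by move=> /a_min ax; rewrite inE => /orP[/eqP ->|//]; rewrite ltnNge ax.
  move=> asi asj ask ij jk.
  have sj := in_s i j asi asj ij; have sk := in_s j k asj ask jk.
  move: asi; rewrite inE => /orP[/eqP -> fak|si]; last exact: rs.
  rewrite leqNgt; apply/negP => fkj.
  have := ra j k; rewrite !mem_filter sj sk fak /= (ltn_trans fak fkj).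
  by move=> /(_ isT isT jk); rewrite leqNgt fkj.
split.
  apply/(pairwise_ordP _ Pf) => j k; rewrite !mem_filter => /andP[/= fj sj] /andP[/= fk sk] jk.
  by apply: (rs a j k); rewrite ?mem_head ?inE ?sj ?sk ?orbT ?a_lt.
by apply/(IHs Ps) => i j k si sj sk; apply: rs; rewrite inE ?si ?sj ?sk orbT.
Qed.

Lemma pattern132E (r : 'I_3) : val (pattern132 r) = nth 0 [:: 0; 2; 1] r.
Proof. by case: r => [[|[|[|]]]] // r_lt3; rewrite permE /=. Qed.

Lemma avoids_word p : avoids p pattern132 = av132 (word p).
Proof.
apply/negP/(av132P _ pairwise_enum) => [noc i j k _ _ _ ij jk fik|avp].
  rewrite leqNgt; apply/negP => fkj; apply: noc; apply/existsP.
  have fij := ltn_trans fik fkj; have ik := ltn_trans ij jk.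
  exists [ffun r : 'I_3 => nth i [:: i; j; k] r]; apply/andP; split.
    apply/forallP => r; apply/forallP => s; rewrite !ffunE.
    by case: r => [[|[|[|]]]] // ?; case: s => [[|[|[|]]]] // ? /=; rewrite ?ij ?jk ?ik.
  apply/forallP => r; apply/forallP => s; rewrite !ffunE !pattern132E.
  by case: r => [[|[|[|]]]] // ?; case: s => [[|[|[|]]]] // ? /=;
    rewrite ?ltnn ?fik ?fkj ?fij // ltnNge ltnW.
move=> /existsP[f /andP[/forallP fmono /forallP fq]].
pose r0 : 'I_3 := Ordinal (isT : 0 < 3); pose r1 : 'I_3 := Ordinal (isT : 1 < 3).
pose r2 : 'I_3 := Ordinal (isT : 2 < 3).
have lt01 : f r0 < f r1 by have /forallP/(_ r1) := fmono r0.
have lt12 : f r1 < f r2 by have /forallP/(_ r2) := fmono r1.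
have lt02 : p (f r0) < p (f r2) by have /forallP/(_ r2) := fq r0; rewrite !pattern132E => /eqP.
have lt21 : p (f r2) < p (f r1) by have /forallP/(_ r1) := fq r2; rewrite !pattern132E => /eqP.
have := avp (f r0) (f r1) (f r2); rewrite !mem_enum => /(_ isT isT isT lt01 lt12 lt02).
by rewrite leqNgt lt21.
Qed.

End Words.

Lemma unique_lis_inj w h h' : unique_lis w h -> unique_lis w h' -> h = h'.
Proof.
move=> U U'; have [m [im mh _]] := U; have [m' [im' mh' _]] := U'.
apply/eqP; rewrite eqn_leq -{1}mh -{2}mh'.
by rewrite (unique_lis_le U' im) (unique_lis_le U im').
Qed.

Lemma unique_lis_size w h : unique_lis w h -> h <= size w.
Proof. by move=> [m [/andP[/eqP <- _] <- _]]; apply: count_size. Qed.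

Lemma ulis_count_gt h n : n < h -> ulis_count h n = 0.
Proof.
move=> lt_nh; apply/eqP; rewrite -leqn0 leqNgt -has_count; apply/hasPn => w avw.
apply/asboolPn => /unique_lis_size; rewrite (size_avoiders132 avw).
by rewrite leqNgt lt_nh.
Qed.

Lemma ulis_avoidersE n :
  ulis_avoiders n pattern132 = \sum_(h < n.+1) ulis_count h n.
Proof.
pose Q w := `[< exists h, unique_lis w h >].
have -> : ulis_avoiders n pattern132 = #|[set p : 'S_n | Q (word p) && av132 (word p)]|.
  apply: eq_card => p; rewrite !inE avoids_word andbC; congr (_ && _).
  by apply/idP/asboolP => /has_ulisP.
rewrite (card_word n (fun w => Q w && av132 w)) -(count_filter Q av132) -/(avoiders132 n).
have countE P : count P (avoiders132 n) = \sum_(w <- avoiders132 n) P w.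
  by rewrite -sum1_count big_mkcond; apply: eq_bigr => w _; case: (P w).
rewrite countE; under [RHS]eq_bigr do rewrite /ulis_count countE.
rewrite exchange_big; apply: eq_big_seq => w avw.
rewrite /Q; case: asboolP => [[h Uh]|noU]; last first.
  by rewrite big1 // => h _; rewrite asboolF // => Uh; apply: noU; exists h.
have lt_hn : h < n.+1 by rewrite ltnS -(size_avoiders132 avw) unique_lis_size.
rewrite (bigD1 (Ordinal lt_hn)) //= asboolT // big1 // => h' h'N.
by rewrite asboolF // => /(unique_lis_inj Uh) hE; rewrite -val_eqE /= -hE eqxx in h'N.
Qed.

Local Open Scope ring_scope.

(** * Generating functions at nilpotent points *)

Section Truncated.
Variables (K : comNzRingType) (N : nat).
Implicit Types (x t : K) (f g h : nat -> K).

(** Power series are evaluated at nilpotent elements, where truncation loses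
    nothing: the identities below hold as soon as x ^+ N = 0. *)
Definition trunc_eval x f : K := \sum_(n < N) f n * x ^+ n.

Definition conv f g (n : nat) : K := \sum_(i < n.+1) f i * g (n - i)%N.

Lemma eq_trunc_eval x f g : (forall n, (n < N)%N -> f n = g n) -> trunc_eval x f = trunc_eval x g.
Proof. by move=> fg; apply: eq_bigr => i _; rewrite fg. Qed.

Lemma trunc_eval0 x f : (forall n, f n = 0) -> trunc_eval x f = 0.
Proof. by move=> f0; rewrite /trunc_eval big1 // => i _; rewrite f0 mul0r. Qed.

Lemma trunc_eval_D x f g : trunc_eval x (fun n => f n + g n) = trunc_eval x f + trunc_eval x g.
Proof. by rewrite -big_split; apply: eq_bigr => i _; rewrite mulrDl. Qed.

Lemma trunc_eval_sum x (I : finType) (F : I -> nat -> K) :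
  trunc_eval x (fun n => \sum_i F i n) = \sum_i trunc_eval x (F i).
Proof. by rewrite exchange_big; apply: eq_bigr => i _; rewrite mulr_suml. Qed.

Lemma trunc_eval_Z x a f : trunc_eval x (fun n => a * f n) = a * trunc_eval x f.
Proof. by rewrite mulr_sumr; apply: eq_bigr => i _; rewrite mulrA. Qed.

Lemma expr_nilpotent x m : x ^+ N = 0 -> (N <= m)%N -> x ^+ m = 0.
Proof. by move=> xN le_Nm; rewrite -(subnK le_Nm) exprD xN mulr0. Qed.

Lemma trunc_eval_shift x f : x ^+ N = 0 -> trunc_eval x f = f 0%N + x * trunc_eval x (fun n => f n.+1).
Proof.
move=> xN; rewrite mulr_sumr.
rewrite -[LHS](_ : \sum_(n < N.+1) f n * x ^+ n = _).
  by rewrite big_ord_recl mulr1; congr (_ + _); apply: eq_bigr => i _; rewrite exprS mulrCA.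
by rewrite big_ord_recr /= xN mulr0 addr0.
Qed.

(** The terms of the product beyond degree N vanish with x ^+ N. *)
Lemma trunc_eval_conv x f g : x ^+ N = 0 -> trunc_eval x (conv f g) = trunc_eval x f * trunc_eval x g.
Proof.
move=> xN; pose F := \poly_(i < N) f i; pose G := \poly_(i < N) g i.
have evE e : trunc_eval x e = (\poly_(i < N) e i).[x].
  by rewrite (horner_coef_wide _ (size_poly N e)); apply: eq_bigr => i _; rewrite coef_poly ltn_ord.
rewrite [trunc_eval x f]evE [trunc_eval x g]evE -hornerM.
have sFG : (size (F * G)%R <= N + (N + N))%N.
  rewrite (leq_trans (size_polyMleq _ _)) // (leq_trans (leq_pred _)) //.
  by rewrite (leq_trans (leq_add (size_poly _ _) (size_poly _ _))) // leq_addl.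
rewrite (horner_coef_wide _ sFG) big_split_ord /= [X in _ + X]big1 ?addr0; last first.
  by move=> i _; rewrite expr_nilpotent ?mulr0 // leq_addr.
apply: eq_bigr => n _; rewrite coefM; congr (_ * _); apply: eq_bigr => i _.
have le_in : (i <= n)%N by rewrite -ltnS.
by rewrite !coef_poly (leq_ltn_trans le_in) // (leq_ltn_trans (leq_subr i n)).
Qed.

(** Multiplication by 1 - t takes differences of the coefficients; the generating
    functions of steps, ramps, squares and cubes follow from it. *)
Lemma trunc_eval_diff t f : t ^+ N = 0 ->
  (1 - t) * trunc_eval t f = f 0%N + t * trunc_eval t (fun n => f n.+1 - f n).
Proof.
move=> tN.
have -> : trunc_eval t (fun n => f n.+1 - f n) = trunc_eval t (fun n => f n.+1) - trunc_eval t f.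
  by rewrite -mulN1r -trunc_eval_Z -trunc_eval_D; apply: eq_trunc_eval => n _; rewrite mulN1r.
rewrite mulrBl mul1r {1}trunc_eval_shift //; ring.
Qed.

Lemma trunc_eval_delta t m : t ^+ N = 0 -> trunc_eval t (fun n => (n == m)%:R) = t ^+ m.
Proof.
move=> tN; have [lt_mN|le_Nm] := ltnP m N; last first.
  rewrite (expr_nilpotent tN le_Nm) /trunc_eval big1 // => i _.
  by rewrite ltn_eqF ?mul0r // (leq_trans (ltn_ord i)).
rewrite /trunc_eval (bigD1 (Ordinal lt_mN)) //= eqxx mul1r big1 ?addr0 // => i.
by rewrite -val_eqE /= => /negbTE ->; rewrite mul0r.
Qed.

Lemma trunc_eval_step t m : t ^+ N = 0 -> (1 - t) * trunc_eval t (fun n => (m <= n)%N%:R) = t ^+ m.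
Proof.
move=> tN; rewrite trunc_eval_diff //; case: m => [|m].
  by rewrite trunc_eval0 ?mulr0 ?addr0 // => n; rewrite subrr.
rewrite add0r exprS -(@trunc_eval_delta t m) //; congr (_ * _); apply: eq_trunc_eval => n _.
by rewrite ltnS; case: ltngtP => _; rewrite ?subrr ?subr0.
Qed.

Lemma trunc_eval_ramp t m : t ^+ N = 0 ->
  (1 - t) ^+ 2 * trunc_eval t (fun n => (n - m)%N%:R) = t ^+ m.+1.
Proof.
move=> tN; rewrite expr2 -mulrA trunc_eval_diff // sub0n add0r mulrCA exprS; congr (_ * _).
rewrite -(trunc_eval_step m) //; congr (_ * _); apply: eq_trunc_eval => n _.
have [le_mn|lt_nm] := leqP m n; first by rewrite subSn // -natr1 addrC addKr.
have [-> ->] : (n.+1 - m = 0 /\ n - m = 0)%N by lia.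
by rewrite subrr.
Qed.

Lemma trunc_eval_sqr t : t ^+ N = 0 ->
  (1 - t) ^+ 3 * trunc_eval t (fun n => (n ^ 2)%N%:R) = t + t ^+ 2.
Proof.
move=> tN; rewrite exprSr -mulrA trunc_eval_diff // add0r.
have -> : trunc_eval t (fun n => (n.+1 ^ 2)%N%:R - (n ^ 2)%N%:R) =
    2 * trunc_eval t (fun n => (n - 0)%N%:R) + trunc_eval t (fun n => (0 <= n)%N%:R).
  rewrite -trunc_eval_Z -trunc_eval_D; apply: eq_trunc_eval => n _.
  by rewrite subn0 leq0n !natrX -[n.+1%:R]natr1 mulr1n; ring.
move: (trunc_eval_ramp 0 tN) (trunc_eval_step 0 tN); set a := trunc_eval _ _; set b := trunc_eval _ _ => aE bE.
have -> : (1 - t) ^+ 2 * (t * (2 * a + b)) =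
  t * (2 * ((1 - t) ^+ 2 * a) + (1 - t) * ((1 - t) * b)) by ring.
by rewrite aE bE; ring.
Qed.

Lemma trunc_eval_cube t : t ^+ N = 0 ->
  (1 - t) ^+ 4 * trunc_eval t (fun n => (n ^ 3)%N%:R) = t + 4 * t ^+ 2 + t ^+ 3.
Proof.
move=> tN; rewrite exprSr -mulrA trunc_eval_diff // add0r.
have -> : trunc_eval t (fun n => (n.+1 ^ 3)%N%:R - (n ^ 3)%N%:R) =
    3 * trunc_eval t (fun n => (n ^ 2)%N%:R)
    + (3 * trunc_eval t (fun n => (n - 0)%N%:R) + trunc_eval t (fun n => (0 <= n)%N%:R)).
  rewrite -!trunc_eval_Z -!trunc_eval_D; apply: eq_trunc_eval => n _.
  by rewrite subn0 leq0n !natrX -[n.+1%:R]natr1 mulr1n; ring.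
move: (trunc_eval_sqr tN) (trunc_eval_ramp 0 tN) (trunc_eval_step 0 tN).
set c := trunc_eval _ _; set a := trunc_eval _ _; set b := trunc_eval _ _ => cE aE bE.
have -> : (1 - t) ^+ 3 * (t * (3 * c + (3 * a + b))) =
  t * (3 * ((1 - t) ^+ 3 * c) + 3 * (1 - t) * ((1 - t) ^+ 2 * a)
       + (1 - t) ^+ 2 * ((1 - t) * b)) by ring.
by rewrite cE aE bE; ring.
Qed.

Lemma geom_double (s : K) : (1 - s) ^+ 2 * \sum_(k < N) k.+1%:R * s ^+ k
  = 1 - N.+1%:R * s ^+ N + N%:R * s ^+ N.+1.
Proof.
elim: N => [|n IHn]; first by rewrite big_ord0; ring.
by rewrite big_ord_recr mulrDr IHn /= !exprS -!natr1; ring.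
Qed.

End Truncated.

(** Here v stands for 1 / (1 + t), so that x = t / (1 + t)^2. *)
Section Closed.
Variables (K : comNzRingType) (N : nat) (t v : K).
Hypotheses (tN : t ^+ N = 0) (tv : v * (1 + t) = 1).
Let x := t * v ^+ 2.

Let xN : x ^+ N = 0. Proof. by rewrite exprMn tN mul0r. Qed.

Definition lis_gf h : K := trunc_eval N x (fun n => (lis_count h n)%:R).
Definition ulis_gf h : K := trunc_eval N x (fun n => (ulis_count h n)%:R).

Lemma conv_natr (f g : nat -> nat) n :
  conv (fun n => (f n)%:R : K) (fun n => (g n)%:R) n =
  (\sum_(i < n.+1) f i * g (n - i)%N)%:R.
Proof. by rewrite natr_sum; apply: eq_bigr => i _; rewrite natrM. Qed.

Lemma lis_gf0 : lis_gf 0 = 1.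
Proof.
rewrite /lis_gf trunc_eval_shift // lis_count0 trunc_eval0 ?mulr0 ?addr0 // => n.
by rewrite lis_count_0S.
Qed.

Lemma lis_gfS h : lis_gf h.+1 = 1 + x * (lis_gf h * lis_gf h.+1).
Proof.
rewrite {1}/lis_gf trunc_eval_shift // lis_count0 -trunc_eval_conv //.
by congr (_ + _ * _); apply: eq_trunc_eval => n _; rewrite lis_count_SS conv_natr.
Qed.

Lemma ulis_gf0 : ulis_gf 0 = 1.
Proof.
rewrite /ulis_gf trunc_eval_shift // ulis_count0 trunc_eval0 ?mulr0 ?addr0 // => n.
by rewrite ulis_count_0S.
Qed.

(** In the recurrence E_(h+2) occurs on both sides; collecting the two terms gives it
    the factor 1 - x A_h, which is the inverse of A_(h+1). *)
Lemma ulis_gfS h : ulis_gf h.+1 = x * ulis_gf h * lis_gf h ^+ 2.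
Proof.
have inv k : lis_gf k.+1 * (1 - x * lis_gf k) = 1.
  by rewrite mulrBr mulr1 {1}lis_gfS; ring.
case: h => [|h].
  rewrite lis_gf0 expr1n mulr1 ulis_gf0 mulr1.
  rewrite /ulis_gf trunc_eval_shift // ulis_count0 add0r.
  rewrite (_ : trunc_eval _ _ _ = ulis_gf 0 * lis_gf 0).
    by rewrite ulis_gf0 lis_gf0 !mulr1.
  by rewrite -trunc_eval_conv //; apply: eq_trunc_eval => n _; rewrite ulis_count_1S conv_natr.
have rec : ulis_gf h.+2 = x * (ulis_gf h.+1 * lis_gf h.+1 + lis_gf h * ulis_gf h.+2).
  rewrite {1}/ulis_gf trunc_eval_shift // ulis_count0 add0r -!trunc_eval_conv // -trunc_eval_D.
  congr (_ * _); apply: eq_trunc_eval => n _; rewrite ulis_count_SS big_split natrD.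
  by rewrite !conv_natr.
rewrite -[LHS]mul1r -(inv h); rewrite -mulrA mulrBl mul1r {1}rec; ring.
Qed.

Let x_tv : x * (1 + t) ^+ 2 = t.
Proof. by rewrite /x -mulrA -exprMn tv expr1n mulr1. Qed.

(** In terms of t the recurrence A_(h+1) (1 - x A_h) = 1 becomes the step from
    1 - t^(h+2) to 1 - t^(h+3). *)
Lemma lis_gf_closed h : lis_gf h * (1 - t ^+ h.+2) = (1 + t) * (1 - t ^+ h.+1).
Proof.
elim: h => [|h IHh]; first by rewrite lis_gf0 mul1r; ring.
have inv : lis_gf h.+1 * (1 - x * lis_gf h) = 1.
  by rewrite mulrBr mulr1 {1}lis_gfS; ring.
have -> : 1 - t ^+ h.+3 = (1 - x * lis_gf h) * ((1 + t) * (1 - t ^+ h.+2)).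
  rewrite mulrBl mul1r.
  have -> : x * lis_gf h * ((1 + t) * (1 - t ^+ h.+2)) =
      x * (1 + t) * (lis_gf h * (1 - t ^+ h.+2)) by ring.
  rewrite IHh.
  have -> : x * (1 + t) * ((1 + t) * (1 - t ^+ h.+1)) =
      x * (1 + t) ^+ 2 * (1 - t ^+ h.+1) by ring.
  by rewrite x_tv !exprS; ring.
by rewrite mulrA inv mul1r.
Qed.

Lemma ulis_gf_closed h :
  ulis_gf h * (1 - t ^+ h.+1) ^+ 2 = t ^+ h * (1 - t) ^+ 2.
Proof.
elim: h => [|h IHh]; first by rewrite ulis_gf0; ring.
have -> : ulis_gf h.+1 * (1 - t ^+ h.+2) ^+ 2 =
    x * ulis_gf h * (lis_gf h * (1 - t ^+ h.+2)) ^+ 2 by rewrite ulis_gfS; ring.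
rewrite lis_gf_closed.
have -> : x * ulis_gf h * ((1 + t) * (1 - t ^+ h.+1)) ^+ 2 =
    (x * (1 + t) ^+ 2) * (ulis_gf h * (1 - t ^+ h.+1) ^+ 2) by ring.
by rewrite IHh x_tv [t ^+ h.+1]exprS; ring.
Qed.

Lemma ulis_gf_series h : t * ulis_gf h =
  (1 - t) ^+ 2 * \sum_(k < N) k.+1%:R * t ^+ (h.+1 * k.+1).
Proof.
have sN : (t ^+ h.+1) ^+ N = 0 by rewrite -exprM mulnC exprM tN expr0n.
have gd : (1 - t ^+ h.+1) ^+ 2 * \sum_(k < N) k.+1%:R * (t ^+ h.+1) ^+ k = 1.
  by rewrite geom_double [_ ^+ N.+1]exprS sN !mulr0 subr0 addr0.
have -> : \sum_(k < N) k.+1%:R * t ^+ (h.+1 * k.+1) =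
    t ^+ h.+1 * \sum_(k < N) k.+1%:R * (t ^+ h.+1) ^+ k.
  rewrite mulr_sumr; apply: eq_bigr => k _.
  by rewrite mulnS exprD exprM mulrCA.
move: gd; set S := \sum_(k < N) _ => gd.
have -> : ulis_gf h = t ^+ h * (1 - t) ^+ 2 * S.
  by rewrite -ulis_gf_closed -mulrA gd mulr1.
by rewrite [t ^+ h.+1]exprS; ring.
Qed.

(** For y <= D this is the sum over m < y of (y - m) sigma(m), with m = (d+1)(k+1)
    counted with weight the divisor k+1; natural subtraction discards m > y. *)
Definition riesz_sum (D y : nat) : nat :=
  \sum_(d < D) \sum_(k < D) k.+1 * (y - d.+1 * k.+1).

(** Each t^((h+1)(k+1)) is replaced by a ramp, at the price of (1 - t)^2: this is the
    double summation that smooths the divisor function. *)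
Lemma sum_ulis_gf :
  t ^+ 2 * \sum_(h < N) ulis_gf h = (1 - t) ^+ 4 * trunc_eval N t (fun y => (riesz_sum N y)%:R).
Proof.
have -> : trunc_eval N t (fun y => (riesz_sum N y)%:R) =
    \sum_(h < N) \sum_(k < N) k.+1%:R * trunc_eval N t (fun y => (y - h.+1 * k.+1)%N%:R).
  under eq_bigr => h _ do under eq_bigr => k _ do rewrite -trunc_eval_Z.
  under eq_bigr => h _ do rewrite -trunc_eval_sum; rewrite -trunc_eval_sum.
  apply: eq_trunc_eval => y _; rewrite /riesz_sum natr_sum; apply: eq_bigr => h _.
  by rewrite natr_sum; apply: eq_bigr => k _; rewrite natrM.
rewrite !mulr_sumr; apply: eq_bigr => h _.
rewrite expr2 -mulrA ulis_gf_series mulrCA.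
rewrite (_ : (1 - t) ^+ 4 = (1 - t) ^+ 2 * (1 - t) ^+ 2); last by ring.
rewrite -mulrA; congr (_ * _); rewrite !mulr_sumr; apply: eq_bigr => k _.
by rewrite [RHS]mulrCA trunc_eval_ramp // exprS mulrCA.
Qed.

End Closed.

(** * Coefficient extraction *)

Import Pdiv.CommonRing Pdiv.RingMonic.

Lemma coef_expr1DX (R : nzRingType) m j : ((1 + 'X : {poly R}) ^+ m)`_j = 'C(m, j)%:R.
Proof.
rewrite addrC exprD1n coef_sum; have [le_jm|lt_mj] := leqP j m; last first.
  rewrite bin_small // big1 // => i _; rewrite coefMn coefXn gtn_eqF ?mul0rn //.
  exact: leq_trans (ltn_ord i) lt_mj.
rewrite (bigD1 (inord j)) //= coefMn coefXn inordK // eqxx big1 ?addr0 //.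
move=> i; rewrite -val_eqE /= inordK // => /negbTE ij.
by rewrite coefMn coefXn eq_sym ij mul0rn.
Qed.

Section Coefficients.
Variables (R : realFieldType) (n : nat).
Hypothesis n_gt0 : (0 < n)%N.

Let N := n.+3.
Let K : comNzRingType := {poly %/ ('X^N : {poly R})}.
Let proj : {rmorphism {poly R} -> K} := in_qpoly ('X^N : {poly R}).
Let t : K := proj 'X.
Let v : K := proj (\sum_(i < N) (- 'X) ^+ i).

(** Up to the power t^(n+1), the factor x^(-n-1) dx/dt of the residue formula for the
    coefficient of x^n, when x = t / (1 + t)^2. *)
Definition binom_kernel : {poly R} := (1 - 'X) * (1 + 'X) ^+ (2 * n).-1.

Definition diff_kernel : {poly R} := (1 - 'X) ^+ 4 * binom_kernel.

(** Computations modulo t^(n+3) determine the coefficients up to degree n+2. *)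
Lemma proj_eq (p q : {poly R}) i : (i <= n.+2)%N -> proj p = proj q -> p`_i = q`_i.
Proof.
move=> le_in /(congr1 (fun z : K => z : {poly R})) /= E.
have mon : ('X^N : {poly R}) \is monic by rewrite monicXn.
have: rmodp (p - q) 'X^N = 0 :> {poly R}.
  move: E; rewrite mk_monic_Xn /= => E.
  by rewrite rmodpB // E subrr.
move=> r0; have := rdivp_eq mon (p - q); rewrite r0 addr0 => pqE.
apply/eqP; rewrite -subr_eq0 -coefB pqE coefMXn.
by rewrite (_ : (i < N)%N) // ltnS.
Qed.

Let tN : t ^+ N = 0.
Proof.
rewrite -rmorphXn /=; apply/val_inj => /=.
by rewrite mk_monic_Xn /= rmodpp ?monicXn.
Qed.

Let tv : v * (1 + t) = 1.
Proof.
rewrite /v; set S := \sum_(i < N) _.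
have SE : S * (1 + 'X) = 1 - (- 'X) ^+ N by rewrite -[RHS]opprB subrX1 -/S; ring.
have -> : proj S * (1 + t) = proj (S * (1 + 'X)) by rewrite rmorphM rmorphD rmorph1.
by rewrite SE rmorphB rmorph1 rmorphXn rmorphN /= exprNn -/t tN mulr0 subr0.
Qed.

Lemma coef_kernel_sum (g : nat -> nat) (q : {poly R}) :
    (1 - t) ^+ 4 * trunc_eval N t (fun y => (g y)%:R) * proj binom_kernel = proj q ->
  \sum_(y < n.+3) (g y)%:R * diff_kernel`_(n.+2 - y) = q`_n.+2.
Proof.
move=> E.
have -> : \sum_(y < n.+3) (g y)%:R * diff_kernel`_(n.+2 - y) =
    ((\poly_(y < N) (g y)%:R) * diff_kernel)`_n.+2.
  by rewrite coefM; apply: eq_bigr => y _; rewrite coef_poly ltn_ord.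
apply: proj_eq => //; rewrite -{}E poly_def mulrC /diff_kernel -mulrA.
rewrite !rmorphM rmorphXn rmorphB rmorph1 -/t -mulrA; congr (_ * _).
rewrite mulrC; congr (_ * _).
rewrite rmorph_sum; apply: eq_bigr => y _.
by rewrite scaler_nat rmorphMn rmorphXn mulr_natl.
Qed.

(** This is the orthogonality behind coefficient extraction: the kernel kills all
    powers of x other than the n-th.  It holds since the two middle binomial
    coefficients of an odd row agree. *)
Lemma coef_central_diff j : (0 < j)%N ->
  ((1 - 'X) * (1 + 'X) ^+ (2 * j).-1 : {poly R})`_j = 0.
Proof.
case: j => // j _; rewrite mulrBl mul1r coefB coefXM /= !coef_expr1DX.
rewrite -[in X in _ - X]bin_sub; last by lia.
by rewrite (_ : ((2 * j.+1).-1 - j = j.+1)%N) ?subrr //; lia.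
Qed.

Let v_expr m k : (k <= m)%N -> v ^+ k * (1 + t) ^+ m = (1 + t) ^+ (m - k).
Proof.
move=> le_km; rewrite -{1}(subnK le_km) exprD mulrCA -exprMn tv expr1n mulr1 //.
Qed.

(** Terms with k > n vanish modulo t^(n+3); for k < n the powers of v are absorbed
    by those of 1 + t; for k = n a single v remains, and t^(n+2) v = t^(n+2). *)
Lemma sum_ulis_proj :
  t ^+ 2 * (\sum_(h < N) ulis_gf N t v h) * proj binom_kernel =
  proj (\sum_(k < n) (ulis_avoiders k pattern132)%:R *:
          ('X^(k.+2) * ((1 - 'X) * (1 + 'X) ^+ (2 * (n - k)).-1))
        + (ulis_avoiders n pattern132)%:R *: 'X^(n.+2)).
Proof.
have -> : \sum_(h < N) ulis_gf N t v h =
    \sum_(k < N) (ulis_avoiders k pattern132)%:R * (t * v ^+ 2) ^+ k.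
  rewrite -[LHS](trunc_eval_sum N _ (fun (h : 'I_N) k => (ulis_count h k)%:R)).
  apply: (@eq_trunc_eval _ _ _ _ (fun k => (ulis_avoiders k pattern132)%:R)) => k lt_kN.
  rewrite ulis_avoidersE natr_sum (big_ord_widen N (fun h => (ulis_count h k)%:R) lt_kN).
  rewrite [RHS]big_mkcond; apply: eq_bigr => h _; case: ltnP => // lt_kh.
  by rewrite ulis_count_gt.
rewrite mulr_sumr mulr_suml.
set F := fun k : nat => t ^+ 2 * ((ulis_avoiders k pattern132)%:R * (t * v ^+ 2) ^+ k)
  * proj binom_kernel.
have projM m : proj ((1 - 'X) * (1 + 'X) ^+ m) = (1 - t) * (1 + t) ^+ m.
  by rewrite rmorphM rmorphXn rmorphB rmorphD rmorph1.
have projB : proj binom_kernel = (1 - t) * (1 + t) ^+ (2 * n).-1 by exact: projM.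
have FE k : F k = (ulis_avoiders k pattern132)%:R *
    (t ^+ k.+2 * ((1 - t) * (v ^+ (2 * k) * (1 + t) ^+ (2 * n).-1))).
  by rewrite /F projB exprMn -exprM !exprS; ring.
rewrite -[LHS]/(\sum_(k < N) F k) !big_ord_recr /=.
have F_big k : (n < k)%N -> F k = 0.
  by move=> lt_nk; rewrite FE (expr_nilpotent tN) ?mul0r ?mulr0 // /N !ltnS.
rewrite (F_big n.+2) // (F_big n.+1) // !addr0 [RHS]rmorphD rmorph_sum; congr (_ + _).
  apply: eq_bigr => k _; have lt_kn := ltn_ord k.
  rewrite FE v_expr; last by lia.
  have -> : ((2 * n).-1 - 2 * k = (2 * (n - k)).-1)%N by lia.
  rewrite scaler_nat rmorphMn -[in RHS]mulr_natl.
  by rewrite [in RHS]rmorphM rmorphXn projM.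
rewrite FE scaler_nat rmorphMn rmorphXn mulr_natl; congr (_ *+ _).
have -> : v ^+ (2 * n) = v * v ^+ (2 * n).-1 by rewrite -exprS prednK // muln_gt0.
rewrite -mulrA v_expr // subnn expr0 mulr1 mulrA mulrBr mulr1 -exprSr tN subr0.
have vE : v = 1 - t * v by apply/eqP; rewrite eq_sym subr_eq -tv; apply/eqP; ring.
by rewrite vE mulrBr mulr1 mulrA -exprSr tN mul0r subr0.
Qed.

Lemma ulis_avoiders_sum :
  (ulis_avoiders n pattern132)%:R =
  \sum_(y < n.+3) (riesz_sum N y)%:R * diff_kernel`_(n.+2 - y) :> R.
Proof.
rewrite (coef_kernel_sum (etrans _ sum_ulis_proj)); last first.
  by rewrite (sum_ulis_gf tN tv).
rewrite coefD coefZ coefXn eqxx mulr1 coef_sum big1 ?add0r // => k _.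
have lt_kn := ltn_ord k.
rewrite coefZ coefXnM ifN; last by rewrite -leqNgt; lia.
by rewrite (_ : (n.+2 - k.+2 = n - k)%N) // coef_central_diff ?mulr0 // subn_gt0.
Qed.

(** The sum is the second difference of the central binomial coefficients of row
    2n. *)
Lemma sum_sqr_kernel :
  \sum_(y < n.+3) (y ^ 2)%N%:R * diff_kernel`_(n.+2 - y) = - 2 * catalan R n.
Proof.
have E : (1 - t) ^+ 4 * trunc_eval N t (fun y => (y ^ 2)%N%:R) * proj binom_kernel =
    proj ('X * ((1 - 'X) ^+ 2 * (1 + 'X) ^+ (2 * n))).
  rewrite exprS -[(1 - t) * _ * _]mulrA trunc_eval_sqr // /binom_kernel.
  have [m ->] : exists m, (2 * n = m.+1)%N by exists (2 * n).-1; lia.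
  rewrite !rmorphM !rmorphXn rmorphB rmorphD rmorph1 -/t /= [_ ^+ m.+1]exprS; ring.
rewrite (coef_kernel_sum E) coefXM /=.
have -> : (1 - 'X) ^+ 2 * (1 + 'X) ^+ (2 * n) =
    (1 + 'X) ^+ (2 * n) - 'X * (1 + 'X) ^+ (2 * n) *+ 2
      + 'X * ('X * (1 + 'X) ^+ (2 * n)) :> {poly R} by ring.
have [m nE] : exists m, n = m.+1 by exists n.-1; lia.
rewrite coefD coefB coefMn !coefXM /= nE /= !coef_expr1DX.
have binS : 'C(2 * m.+1, m) = 'C(2 * m.+1, m.+2).
  by rewrite -bin_sub; [congr 'C(_, _) |]; lia.
have /(congr1 (fun k => k%:R : R)) : (m.+2 * 'C(2 * m.+1, m.+2) = m.+1 * 'C(2 * m.+1, m.+1))%N.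
  by rewrite mul_bin_left; congr (_ * _)%N; lia.
rewrite /catalan binS !natrM; set a := 'C(_, m.+2)%:R; set b := 'C(_, m.+1)%:R => ab.
have m2 : m.+2%:R != 0 :> R by rewrite pnatr_eq0.
apply: (mulfI m2); rewrite [RHS]mulrCA -[X in _ = _ * X]mulrC divfK //.
move: ab; rewrite -[m.+2%:R]natr1 => ab.
have -> : (m.+1%:R + 1) * (a - b *+ 2 + a) =
  ((m.+1%:R + 1) * a) *+ 2 - (m.+1%:R + 1) * b *+ 2 by ring.
by rewrite ab; ring.
Qed.

(** The sum is the central coefficient of an antisymmetric polynomial. *)
Lemma sum_cube_kernel :
  \sum_(y < n.+3) (y ^ 3)%N%:R * diff_kernel`_(n.+2 - y) = 0.
Proof.
have E : (1 - t) ^+ 4 * trunc_eval N t (fun y => (y ^ 3)%N%:R) * proj binom_kernel =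
    proj ('X * ((1 + 'X *+ 3 - 'X^2 *+ 3 - 'X^3) * (1 + 'X) ^+ (2 * n).-1)).
  rewrite trunc_eval_cube // /binom_kernel.
  rewrite !(rmorphM, rmorphXn, rmorphB, rmorphD, rmorph1, rmorphMn) /= -/t; ring.
rewrite (coef_kernel_sum E) coefXM /=; set P := (1 + 'X) ^+ _.
have -> : (1 + 'X *+ 3 - 'X^2 *+ 3 - 'X^3) * P =
  P + ('X * P) *+ 3 - ('X * ('X * P)) *+ 3 - 'X * ('X * ('X * P)) by ring.
have [m nE] : exists m, n = m.+1 by exists n.-1; lia.
rewrite !(coefB, coefD, coefN, coefMn, coefXM) nE /= !coef_expr1DX nE.
have bin_sym i j : (i + j = (2 * m.+1).-1)%N -> 'C((2 * m.+1).-1, i) = 'C((2 * m.+1).-1, j).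
  by move=> ijE; rewrite -bin_sub; [congr 'C(_, _) |]; lia.
rewrite (bin_sym m m.+1); last by lia.
case: m {nE} bin_sym => [|m] bin_sym; first by rewrite (@bin_small _ 2) //=; ring.
by rewrite (bin_sym m m.+3); [rewrite /=; ring | lia].
Qed.

End Coefficients.

(** * Size of the kernel *)

Section KernelBound.
Variable R : realFieldType.

Lemma le_of_eq (a b : R) : a = b -> a <= b.
Proof. by move->. Qed.

Lemma ffact_natr n m : (n ^_ m)%:R = \prod_(i < m) (n%:R - i%:R) :> R.
Proof.
elim: m => [|m IHm]; first by rewrite big_ord0 ffactn0.
rewrite big_ord_recr /= -IHm ffactnSr natrM.
have [le_mn|lt_nm] := leqP m n; first by rewrite natrB.
by rewrite ffact_small // !mul0r.
Qed.

(** Within range, both sides times (j - i)! (N - j + i)! are (N + i + l)!. *)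
Lemma bin_shift_ffact N i l j : (i <= j)%N ->
  ('C(N, j - i) * (N + i + l) ^_ (i + l) =
   'C(N + i + l, j) * (j ^_ i * (N + i + l - j) ^_ l))%N.
Proof.
move=> le_ij; have [le_jN|lt_Nj] := leqP (j - i) N; last first.
  rewrite bin_small // mul0n; have [le_j|lt_j] := leqP j (N + i + l).
    have -> : ((N + i + l - j) ^_ l = 0)%N by apply: ffact_small; lia.
    by rewrite !muln0.
  by rewrite bin_small.
have [Dil Dl Dj] : [/\ i + l <= N + i + l, l <= N + i + l - j & j <= N + i + l]%N.
  by split; lia.
have F1 := ffact_fact Dil.
have F2 := ffact_fact le_ij.
have F3 := ffact_fact Dl.
have B1 := bin_fact le_jN.
have B2 := bin_fact Dj.
apply/eqP; rewrite -(eqn_pmul2r (_ : 0 < (j - i)`! * (N - (j - i))`!)%N); last first.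
  by rewrite muln_gt0 !fact_gt0.
apply/eqP; rewrite mulnAC B1.
have -> : ('C(N + i + l, j) * (j ^_ i * (N + i + l - j) ^_ l) *
    ((j - i)`! * (N - (j - i))`!) =
  'C(N + i + l, j) * ((j ^_ i * (j - i)`!) *
     ((N + i + l - j) ^_ l * (N - (j - i))`!)))%N by ring.
rewrite F2 (_ : N - (j - i) = N + i + l - j - l)%N ?F3 ?B2; try lia.
by rewrite mulnC -[in RHS]F1; congr (_ * _`!)%N; lia.
Qed.

(** Each binomial coefficient of row 2n-1 is the one of row 2n+4 times falling
    factorials of n+2-y and n+2+y; the alternating sum of these, a Krawtchouk
    polynomial of degree 5, is odd in y. *)
Lemma diff_kernel_coef (n y : nat) : (0 < n)%N -> (y <= n.+2)%N ->
  let M : R := n.+2%:R in let Y : R := y%:R in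
  (diff_kernel R n)`_(n.+2 - y) * ((2 * n.+2) ^_ 5)%:R =
  'C(2 * n.+2, n.+2 + y)%:R *
    (32 * Y ^+ 5 + (160 - 160 * M) * Y ^+ 3 + (120 * M ^+ 2 - 200 * M + 48) * Y).
Proof.
move=> n_gt0 le_yM M Y.
set j := (n.+2 - y)%N; set P : {poly R} := (1 + 'X) ^+ (2 * n).-1.
have binE i : (i <= 5)%N -> ('X^i * P)`_j * ((2 * n.+2) ^_ 5)%:R =
    'C(2 * n.+2, n.+2 + y)%:R *
     (\prod_(k < i) (M - Y - k%:R) * \prod_(k < 5 - i) (M + Y - k%:R)).
  move=> le_i5; rewrite coefXnM.
  (* The falling factorials vanish when j < i, as does the coefficient. *)
  have -> : M - Y = j%:R by rewrite natrB.
  have -> : M + Y = (2 * n.+2 - j)%N%:R by rewrite -natrD; congr _%:R; lia.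
  rewrite -!ffact_natr -!natrM; case: ltnP => [lt_ji|le_ij].
    by rewrite (@ffact_small j i) // mul0n muln0 mul0r.
  rewrite coef_expr1DX -natrM; congr _%:R.
  have := bin_shift_ffact (2 * n).-1 (5 - i) le_ij.
  rewrite (_ : (2 * n).-1 + i + (5 - i) = 2 * n.+2)%N; last by lia.
  rewrite (_ : i + (5 - i) = 5)%N; last by lia.
  move=> ->; rewrite -[in LHS]bin_sub; last by lia.
  by congr ('C(_, _) * _)%N; lia.
have -> : diff_kernel R n = 'X^0 * P - 'X^1 * P *+ 5 + 'X^2 * P *+ 10 - 'X^3 * P *+ 10
    + 'X^4 * P *+ 5 - 'X^5 * P.
  rewrite /diff_kernel /binom_kernel -/P; ring.
rewrite !(coefB, coefD, coefN, coefMn).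
transitivity (('X^0 * P)`_j * ((2 * n.+2) ^_ 5)%:R
  - (('X^1 * P)`_j * ((2 * n.+2) ^_ 5)%:R) *+ 5
  + (('X^2 * P)`_j * ((2 * n.+2) ^_ 5)%:R) *+ 10
  - (('X^3 * P)`_j * ((2 * n.+2) ^_ 5)%:R) *+ 10
  + (('X^4 * P)`_j * ((2 * n.+2) ^_ 5)%:R) *+ 5
  - ('X^5 * P)`_j * ((2 * n.+2) ^_ 5)%:R).
  by move: (_ ^_ 5) => q; ring.
rewrite !binE // !big_ord_recr !big_ord0 /=.
by move: ('C(_, _)) => q; ring.
Qed.

Lemma exprS_diff_le (y : R) k : 0 <= y ->
  (y + 1) ^+ k.+1 - y ^+ k.+1 <= k.+1%:R * (y + 1) ^+ k.
Proof.
move=> y0; elim: k => [|k IHk]; first by rewrite !expr1 expr0; lra.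
have -> : (y + 1) ^+ k.+2 - y ^+ k.+2 =
    (y + 1) * ((y + 1) ^+ k.+1 - y ^+ k.+1) + y ^+ k.+1 by rewrite ![_ ^+ k.+2]exprS; ring.
have y1 : 0 <= y + 1 by lra.
have le1 := ler_wpM2l y1 IHk.
have le2 : y ^+ k.+1 <= (y + 1) ^+ k.+1 by rewrite lerXn2r ?nnegrE //; lra.
apply: le_trans (lerD le1 le2) _.
by rewrite -[k.+2%:R]natr1 [(y + 1) ^+ k.+1]exprS; apply: le_of_eq; ring.
Qed.

Section Moments.
Variable M : nat.

Let b (y : nat) : R := 'C(2 * M, M + y)%:R.
Let D (y : nat) : R := (M + y)%:R * b y.

Definition moment k : R := \sum_(y < M.+1) y%:R ^+ k * 'C(2 * M, M + y)%:R.

Let D_diff y : (y <= M)%N -> 2 * y%:R * b y = D y - D y.+1.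
Proof.
move=> le_yM; have := mul_bin_left (2 * M) (M + y).
rewrite /D /b -addnS => /(congr1 (fun k => k%:R : R)); rewrite !natrM => ->.
rewrite (_ : 2 * M - (M + y) = M - y)%N; last by lia.
by rewrite natrB // natrD; ring.
Qed.

Let D_gt : D M.+1 = 0.
Proof. by rewrite /D /b bin_small ?mulr0 //; lia. Qed.

(** With D(y) = (M + y) C(2M, M + y) one has 2 y C(2M, M + y) = D(y) - D(y+1), so that
    odd moments are computed by summation by parts. *)
Lemma moment_telescope (f : nat -> R) :
  \sum_(y < M.+1) 2 * y%:R * f y * b y =
  M%:R * f 0%N * b 0 + \sum_(y < M) (f y.+1 - f y) * D y.+1.
Proof.
have H L : (L <= M)%N -> \sum_(y < L.+1) 2 * y%:R * f y * b y + f L * D L.+1 =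
    f 0%N * D 0 + \sum_(y < L) (f y.+1 - f y) * D y.+1.
  elim: L => [_|L IHL lt_LM].
    rewrite big_ord_recl !big_ord0 /= addr0.
    by have := D_diff (leq0n M); rewrite mulr0 !mul0r => /eqP; rewrite eq_sym subr_eq0 => /eqP ->; rewrite add0r addr0.
  rewrite big_ord_recr [in RHS]big_ord_recr /= addrA -IHL ?(ltnW lt_LM) //.
  by move: (D_diff lt_LM) => E; rewrite mulrAC E; ring.
by have := H M (leqnn M); rewrite D_gt mulr0 addr0 => ->; rewrite /D addn0; ring.
Qed.

Lemma moment1 : 2 * moment 1 = M%:R * 'C(2 * M, M)%:R.
Proof.
have := moment_telescope (fun=> 1); rewrite [X in _ + X]big1; last first.
  by move=> y _; rewrite subrr mul0r.
rewrite addr0 mulr1 /b addn0 => <-; rewrite mulr_sumr; apply: eq_bigr => y _.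
by rewrite expr1 mulr1 mulrA.
Qed.

Lemma momentSS k : moment k.+3 <= k.+2%:R * M%:R * moment k.+1.
Proof.
rewrite -(ler_pM2l (ltr0Sn R 1)).
have -> : 2 * moment k.+3 = \sum_(y < M) (y.+1%:R ^+ k.+2 - y%:R ^+ k.+2) * D y.+1.
  have := moment_telescope (fun y => y%:R ^+ k.+2).
  rewrite exprS !mul0r mulr0 mul0r add0r => <-.
  by rewrite mulr_sumr; apply: eq_bigr => y _; rewrite [_ ^+ k.+3]exprS; ring.
rewrite /moment big_ord_recl exprS !mul0r add0r !mulr_sumr; apply: ler_sum => y _.
rewrite /D lift0 -/(b y.+1).
have b0 : 0 <= b y.+1 by [].
have Dle : (M + y.+1)%:R * b y.+1 <= 2 * M%:R * b y.+1.
  by rewrite ler_wpM2r // -natrM ler_nat; have := ltn_ord y; lia.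
have fle := @exprS_diff_le y%:R k.+1 (ler0n _ _); rewrite natr1 in fle.
have f0 : 0 <= y.+1%:R ^+ k.+2 - y%:R ^+ k.+2 :> R.
  by rewrite subr_ge0 lerXn2r ?nnegrE // ler_nat.
apply: le_trans (ler_pM f0 _ fle Dle) _; first by rewrite mulr_ge0.
by apply: le_of_eq; ring.
Qed.

Lemma moments_le : let B := 'C(2 * M, M)%:R : R in
  [/\ moment 3 <= M%:R ^+ 2 * B, moment 5 <= 4 * M%:R ^+ 3 * B
    & moment 7 <= 24 * M%:R ^+ 4 * B].
Proof.
move=> B; have M0 : 0 <= M%:R :> R by [].
have E1 : moment 1 = M%:R * B / 2 by rewrite -moment1; field.
have L3 : moment 3 <= M%:R ^+ 2 * B.
  by apply: le_trans (momentSS 0) _; rewrite E1; apply: le_of_eq; field.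
have L5 : moment 5 <= 4 * M%:R ^+ 3 * B.
  apply: le_trans (momentSS 2) _.
  have := ler_wpM2l (mulr_ge0 (ler0n R 4) M0) L3; move/le_trans; apply.
  by apply: le_of_eq; ring.
split=> //; apply: le_trans (momentSS 4) _.
have := ler_wpM2l (mulr_ge0 (ler0n R 6) M0) L5; move/le_trans; apply.
by apply: le_of_eq; ring.
Qed.

End Moments.

Lemma quintic_le (M Y : R) : 1 <= M -> 0 <= Y ->
  `|32 * Y ^+ 5 + (160 - 160 * M) * Y ^+ 3 + (120 * M ^+ 2 - 200 * M + 48) * Y|
  <= 200 * (Y ^+ 5 + M * Y ^+ 3 + M ^+ 2 * Y).
Proof.
move=> M1 Y0; have Y3 : 0 <= Y ^+ 3 by rewrite exprn_ge0.
have Y5 : 0 <= Y ^+ 5 by rewrite exprn_ge0.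
have MY3 : 0 <= (M - 1) * Y ^+ 3 by rewrite mulr_ge0 // subr_ge0.
have MY : 0 <= (M - 1) * Y by rewrite mulr_ge0 // subr_ge0.
have MMY : 0 <= (M - 1) * ((M - 1) * Y) by rewrite mulr_ge0 // subr_ge0.
by rewrite ler_norml; apply/andP; split; nra.
Qed.

Lemma diff_kernel_le n y : (2 <= n)%N -> (y <= n.+2)%N ->
  `|(diff_kernel R n)`_(n.+2 - y)| * n.+2%:R ^+ 5 <=
  200 * 'C(2 * n.+2, n.+2 + y)%:R *
    (y%:R ^+ 5 + n.+2%:R * y%:R ^+ 3 + n.+2%:R ^+ 2 * y%:R).
Proof.
move=> n2 le_yM; set M : R := n.+2%:R; set Y : R := y%:R.
have M4 : 4 <= M by rewrite ler_nat !ltnS.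
have Y0 : 0 <= Y by [].
have MF : M ^+ 5 <= ((2 * n.+2) ^_ 5)%:R.
  rewrite ffact_natr natrM -/M !big_ord_recr big_ord0 /= mul1r.
  rewrite !exprS expr0 mulr1 !mulrA.
  by do 4?[apply: ler_pM; rewrite ?mulr_ge0 //; try lra].
have F0 : 0 <= ((2 * n.+2) ^_ 5)%:R :> R by [].
apply: le_trans (ler_wpM2l (normr_ge0 _) MF) _.
rewrite -[X in _ * X]ger0_norm // -normrM diff_kernel_coef //; last by lia.
rewrite normrM ger0_norm // [200 * 'C(_, _)%:R]mulrC -mulrA ler_wpM2l //.
by apply: quintic_le => //; lra.
Qed.

Lemma central_bin_le n : 'C(2 * n.+1, n.+1)%:R <= 4 * 'C(2 * n, n)%:R :> R.
Proof.
rewrite -natrM ler_nat -(leq_pmul2l (ltn0Sn n)).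
have E1 := mul_bin_diag (2 * n).+2 n; have E2 := mul_bin_down (2 * n).+1 n.
rewrite /= in E1 E2; rewrite (_ : 2 * n.+1 = (2 * n).+2)%N; last by lia.
rewrite -E1.
have E2' : (n.+1 * 'C((2 * n).+1, n) = (2 * n).+1 * 'C(2 * n, n))%N.
  by rewrite E2; congr (_ * _)%N; lia.
nia.
Qed.

Lemma central_bin_catalan n : 'C(2 * n.+2, n.+2)%:R <= 16 * n.+2%:R * catalan R n.
Proof.
have C0 : 0 <= 'C(2 * n, n)%:R :> R by [].
have L1 := central_bin_le n; have L2 := central_bin_le n.+1.
have -> : 16 * n.+2%:R * catalan R n =
    16 * 'C(2 * n, n)%:R + 16 * ('C(2 * n, n)%:R / n.+1%:R).
  rewrite /catalan -[n.+2%:R]natr1; have : n.+1%:R != 0 :> R by rewrite pnatr_eq0.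
  by move: n.+1%:R => x x0; field.
have : 0 <= 'C(2 * n, n)%:R / n.+1%:R :> R by rewrite divr_ge0.
by move: ('C(2 * n, n)%:R / _) => q; lra.
Qed.

(** The three monomials of the quintic bound lead to the moments 7, 5 and 3 with
    weights 1, M and M^2, all of order M^4 times the central binomial coefficient, against M^5. *)
Lemma kernel_sqr_sum n : (2 <= n)%N ->
  \sum_(y < n.+3) y%:R ^+ 2 * `|(diff_kernel R n)`_(n.+2 - y)| <=
  300 * 320 * catalan R n.
Proof.
move=> n2; set M : R := n.+2%:R.
have M4 : 4 <= M by rewrite ler_nat !ltnS.
have M5 : 0 < M ^+ 5 by rewrite exprn_gt0 //; lra.
rewrite -(ler_pM2r M5) mulr_suml.
have : \sum_(y < n.+3) y%:R ^+ 2 * `|(diff_kernel R n)`_(n.+2 - y)| * M ^+ 5 <=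
    200 * (moment n.+2 7 + M * moment n.+2 5 + M ^+ 2 * moment n.+2 3).
  rewrite /moment ![_ * \sum_(_ < _) _]mulr_sumr -!big_split mulr_sumr.
  apply: ler_sum => y _ /=; rewrite -mulrA.
  apply: le_trans (ler_wpM2l (exprn_ge0 2 (ler0n R y)) (diff_kernel_le n2 (leq_ord y))) _.
  by apply: le_of_eq; rewrite -/M; ring.
have [L3 L5 L7] := moments_le n.+2; rewrite -/M in L3 L5 L7.
have L5' := ler_wpM2l (_ : 0 <= M) L5; have L3' := ler_wpM2l (_ : 0 <= M ^+ 2) L3.
have LC := ler_wpM2l (_ : 0 <= M ^+ 4) (central_bin_catalan n); rewrite -/M in LC.
have M0 : 0 <= M by lra.
have {}L5' := L5' M0; have {}L3' := L3' (exprn_ge0 2 M0).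
have {}LC := LC (exprn_ge0 4 M0).
have cat0 : 0 <= M ^+ 5 * catalan R n by rewrite mulr_ge0 ?exprn_ge0 ?divr_ge0.
move: LC L3' L5' L7; set B := 'C(_, _)%:R => LC L3' L5' L7.
rewrite (_ : M ^+ 4 * (16 * M * catalan R n) = 16 * (M ^+ 5 * catalan R n)) in LC; last by ring.
rewrite (_ : M ^+ 2 * (M ^+ 2 * B) = M ^+ 4 * B) in L3'; last by ring.
rewrite (_ : M * (4 * M ^+ 3 * B) = 4 * (M ^+ 4 * B)) in L5'; last by ring.
rewrite -[24 * _ * B]mulrA in L7.
rewrite (_ : 300 * 320 * catalan R n * M ^+ 5 = 300 * 320 * (M ^+ 5 * catalan R n)); last by ring.
lra.
Qed.

(** Lowering the moments by 2 gains a factor 1 / M. *)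
Lemma kernel_sum n : (2 <= n)%N ->
  (\sum_(y < n.+3) `|(diff_kernel R n)`_(n.+2 - y)|) * n.+2%:R <=
  300 * 320 * catalan R n.
Proof.
move=> n2; set M : R := n.+2%:R.
have M4 : 4 <= M by rewrite ler_nat !ltnS.
have M0 : 0 <= M by lra.
have M4' : 0 < M ^+ 4 by rewrite exprn_gt0 //; lra.
rewrite -(ler_pM2r M4') -[X in X <= _]mulrA -exprS mulr_suml.
have : \sum_(y < n.+3) `|(diff_kernel R n)`_(n.+2 - y)| * M ^+ 5 <=
    200 * (moment n.+2 5 + M * moment n.+2 3 + M ^+ 2 * moment n.+2 1).
  rewrite /moment ![_ * \sum_(_ < _) _]mulr_sumr -!big_split mulr_sumr.
  apply: ler_sum => y _ /=.
  apply: le_trans (diff_kernel_le n2 (leq_ord y)) _.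
  by apply: le_of_eq; rewrite -/M; ring.
have [L3 L5 _] := moments_le n.+2; have E1 := moment1 n.+2; rewrite -/M in L3 L5 E1.
have L3' := ler_wpM2l M0 L3.
have LC := ler_wpM2l (exprn_ge0 3 M0) (central_bin_catalan n); rewrite -/M in LC.
have cat0 : 0 <= M ^+ 4 * catalan R n by rewrite mulr_ge0 ?exprn_ge0 ?divr_ge0.
move: LC L3' L5 E1; set B := 'C(_, _)%:R => LC L3' L5 E1.
have E1' : M ^+ 2 * moment n.+2 1 = M ^+ 3 * B / 2.
  by rewrite (_ : moment n.+2 1 = M * B / 2); [field | rewrite -E1; field].
rewrite (_ : M ^+ 3 * (16 * M * catalan R n) = 16 * (M ^+ 4 * catalan R n)) in LC; last by ring.
rewrite (_ : M * (M ^+ 2 * B) = M ^+ 3 * B) in L3'; last by ring.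
rewrite -[4 * _ * B]mulrA in L5.
rewrite (_ : 300 * 320 * catalan R n * M ^+ 4 = 300 * 320 * (M ^+ 4 * catalan R n)); last by ring.
rewrite E1'; lra.
Qed.

End KernelBound.

(** * Asymptotics of the smoothed divisor sum *)

(** The terms with d >= y / k vanish and the others are in arithmetic
    progression. *)
Lemma double_sum_sub (y k D : nat) : (0 < k)%N -> (y <= D)%N ->
  (2 * \sum_(d < D) (y - d.+1 * k) = y %/ k * (2 * y - k * (y %/ k).+1))%N.
Proof.
move=> k0 leyD; set q := (y %/ k)%N.
have leqD : (q <= D)%N by rewrite (leq_trans _ leyD) // leq_div.
have qk : (q * k <= y)%N by rewrite /q leq_divM.
have yqk : (y < q.+1 * k)%N by rewrite /q -ltn_divLR.
rewrite -(big_mkord xpredT (fun d => y - d.+1 * k)%N) (big_cat_nat (n := q)) //=.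
rewrite [X in (_ + X)%N]big1_seq ?addn0; last first.
  move=> d; rewrite mem_index_iota => /andP[_ /andP[led _]]; apply/eqP; rewrite subn_eq0 ltnW //.
  by apply: leq_trans yqk _; rewrite leq_mul2r ltnS led orbT.
rewrite big_mkord; clear yqk leqD; elim: q qk => [|q IHq] qk; first by rewrite big_ord0.
rewrite big_ord_recr /= mulnDr IHq; last by nia.
nia.
Qed.

(** With y = q k + r the closed form becomes (y - r) (y + r - k).  This isolates the
    linear term k y, whose sum over k produces the coefficient of y^2. *)
Lemma weighted_sum_sub (y k D : nat) : (0 < k)%N -> (y <= D)%N ->
  (2 * \sum_(d < D) k * (y - d.+1 * k) + (k * y + (y %% k) ^ 2) =
   y ^ 2 + k * (y %% k))%N.
Proof.
move=> k0 leyD; rewrite -big_distrr /= mulnCA double_sum_sub //.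
have := ltn_pmod y k0; have := divn_eq y k.
move: (y %/ k)%N (y %% k)%N => q r yE rk.
have -> : (2 * y - k * q.+1 = q * k + 2 * r - k)%N by rewrite yE mulnS [(k * q)%N]mulnC; lia.
rewrite yE; have [->|q0] := posnP q; first by rewrite !mul0n !add0n muln0 add0n addnC.
have kqk : (k <= q * k)%N by rewrite leq_pmull.
 have [m mE] : exists m, (q * k + 2 * r = k + m)%N.
  by exists (q * k + 2 * r - k)%N; lia.
rewrite mE addKn; nia.
Qed.

Section Divisors.
Variable R : realFieldType.

(** As a function of k this vanishes at the points y / q and is a parabola between
    two consecutive ones, where the quotient of y by k is constant. *)
Definition remainder_prod (y k : nat) : R := (y %% k)%N%:R * (k%:R - (y %% k)%N%:R).

Lemma sum_succ_natr n : \sum_(k < n) k.+1%:R = n%:R * (n%:R + 1) / 2 :> R.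
Proof.
elim: n => [|n IHn]; first by rewrite big_ord0 !mul0r.
by rewrite big_ord_recr IHn /= -!natr1; field.
Qed.

(** Summing over the cofactor d first makes the term - y^2 / 4 appear; the rest
    depends only on the remainders of y. *)
Lemma riesz_sum_remainder y D : (y <= D)%N ->
  (riesz_sum D y)%:R = y%:R ^+ 3 / 4 - y%:R ^+ 2 / 4 + (\sum_(k < y) remainder_prod y k.+1) / 2 :> R.
Proof.
move=> leyD.
have termE k : (\sum_(d < D) k.+1 * (y - d.+1 * k.+1))%N%:R =
    (y%:R ^+ 2 - k.+1%:R * y%:R + remainder_prod y k.+1) / 2 :> R.
  have := congr1 (fun m => m%:R : R) (weighted_sum_sub (ltn0Sn k) leyD).
  rewrite natrD [X in _ + X = _]natrD [in RHS]natrD !natrX !natrM /remainder_prod; move: (k.+1%:R : R) => k' E.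
  lra.
rewrite /riesz_sum exchange_big natr_sum.
rewrite -(big_mkord xpredT (fun k => (\sum_(d < D) k.+1 * (y - d.+1 * k.+1))%N%:R)).
rewrite (big_cat_nat (n := y)) // [X in _ + X = _]big1_seq ?addr0; last first.
  move=> k; rewrite mem_index_iota => /andP[_ /andP[leyk _]].
  rewrite big1 // => d _; rewrite (_ : y - _ = 0)%N ?muln0 //; nia.
rewrite big_mkord; under eq_bigr => k _ do rewrite termE.
rewrite -mulr_suml big_split /= sumrB sumr_const card_ord.
by rewrite -[\sum_(k < y) _.+1%:R * _]mulr_suml sum_succ_natr -[_ *+ y]mulr_natr; field.
Qed.

(** H is the discrete antiderivative of the parabola
    (y - q k) ((q + 1) k - y). *)
Lemma remainder_sum_closed (y q : nat) (m m' : nat) : (m <= m')%N ->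
    (forall k, (m < k <= m')%N -> (y %/ k = q)%N) ->
  let Y : R := y%:R in let Q : R := q%:R in
  let H (u : R) : R := - Y ^+ 2 * u + (2 * Q + 1) * Y * (u * (u + 1) / 2)
    - Q * (Q + 1) * (u * (u + 1) * (2 * u + 1) / 6) in
  \sum_(k < m') remainder_prod y k.+1 = \sum_(k < m) remainder_prod y k.+1 + (H m'%:R - H m%:R).
Proof.
move=> /subnKC <-; elim: (m' - m)%N => [|l IHl] yq Y Q H.
  by rewrite addn0 subrr addr0.
rewrite addnS big_ord_recr IHl /=; last by move=> k kl; apply: yq; lia.
rewrite -addrA; congr (_ + _).
have Dk := yq (m + l).+1 (_ : (m < (m + l).+1 <= m + l.+1)%N).
have {}Dk : (y %/ (m + l).+1 = q)%N by apply: Dk; lia.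
have rE : (y %% (m + l).+1)%N%:R = Y - Q * (m + l).+1%:R.
  by rewrite /Y {2}(divn_eq y (m + l).+1) Dk natrD natrM; ring.
by rewrite /remainder_prod rE /H -!natr1; field.
Qed.

(** The sum over the integers of a parabola vanishing at both ends of an interval of
    length w differs from its integral, proportional to w^3, by O(w + 1): the
    quadratic terms in w cancel.  The factor Q (Q + 1) is the curvature.  Here a and b are the fractional parts of the
    ends. *)
Lemma parabola_sum_error (w Q a b : R) (Y := w * (Q * (Q + 1)))
    (H := fun u : R => - Y ^+ 2 * u + (2 * Q + 1) * Y * (u * (u + 1) / 2)
      - Q * (Q + 1) * (u * (u + 1) * (2 * u + 1) / 6)) :
    0 <= w -> 0 <= Q -> 0 <= a <= 1 -> 0 <= b <= 1 ->
  `|H (w * (Q + 1) - b) - H (w * Q - a) - w ^+ 3 * (Q * (Q + 1)) / 6|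
  <= Y + Q * (Q + 1).
Proof.
move=> w0 Q0 /andP[a0 a1] /andP[b0 b1].
have -> : H (w * (Q + 1) - b) - H (w * Q - a) - w ^+ 3 * (Q * (Q + 1)) / 6 =
    Q * (Q + 1) / 6 * (w * (3 * (a * (1 - a)) + 3 * (b * (1 - b)) - 1)
      + (a * (1 - a) * (2 * a - 1) - b * (1 - b) * (2 * b - 1))).
  by rewrite /H /Y; field.
have QQ : 0 <= Q * (Q + 1) by rewrite mulr_ge0 //; lra.
have E (a' : R) : 0 <= a' -> a' <= 1 ->
    [/\ 0 <= a' * (1 - a'), a' * (1 - a') <= 1 / 4
      & `|a' * (1 - a') * (2 * a' - 1)| <= 1 / 4].
  move=> a'0 a'1; have h0 : 0 <= a' * (1 - a') by rewrite mulr_ge0 // subr_ge0.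
  have h1 : a' * (1 - a') <= 1 / 4 by have := sqr_ge0 (2 * a' - 1); nra.
  split=> //; rewrite normrM ger0_norm //.
  have h2 : `|2 * a' - 1| <= 1 by rewrite ler_norml; apply/andP; split; lra.
  by have := normr_ge0 (2 * a' - 1); nra.
have [A0 A1 A2] := E a a0 a1; have [B0 B1 B2] := E b b0 b1.
rewrite normrM ger0_norm ?divr_ge0 //.
have : `|w * (3 * (a * (1 - a)) + 3 * (b * (1 - b)) - 1)
      + (a * (1 - a) * (2 * a - 1) - b * (1 - b) * (2 * b - 1))| <= w + 1.
  apply: le_trans (ler_normD _ _) _; apply: lerD.
    rewrite normrM ger0_norm // -[X in _ <= X]mulr1 ler_wpM2l //.
    by rewrite ler_norml; apply/andP; split; lra.
  apply: le_trans (ler_normB _ _) _; lra.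
rewrite /Y; set e := `|_| => le_e.
have h1 : 0 <= Q * (Q + 1) * (w + 1 - e) by rewrite mulr_ge0 // subr_ge0.
have h2 : 0 <= w * (Q * (Q + 1)) by rewrite mulr_ge0.
by move: (Q * (Q + 1)) QQ h1 h2 => q q0 h1 h2; lra.
Qed.

Lemma remainder_block (y q : nat) : (0 < q)%N ->
  `|\sum_(k < y %/ q) remainder_prod y k.+1 - \sum_(k < y %/ q.+1) remainder_prod y k.+1
     - y%:R ^+ 3 / 6 * (q%:R ^+ 2 * q.+1%:R ^+ 2)^-1|
  <= y%:R + q%:R * q.+1%:R.
Proof.
move=> q0.
have yq k : (y %/ q.+1 < k <= y %/ q)%N -> (y %/ k = q)%N.
  move=> /andP[lt_k le_k]; have k0 : (0 < k)%N by apply: leq_ltn_trans lt_k.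
  apply/eqP; rewrite eqn_leq leq_divRL // -ltnS ltn_divLR //.
  by move: lt_k le_k; rewrite ltn_divLR // leq_divRL // ![(k * _)%N]mulnC => -> ->.
have le_N : (y %/ q.+1 <= y %/ q)%N by apply: leq_div2l.
have := remainder_sum_closed le_N yq => /= ->; rewrite [_ + (_ - _)]addrC addrK.
have Q0 : 0 < q%:R :> R by rewrite ltr0n.
have Q1 : 0 < q.+1%:R :> R by rewrite ltr0n.
have frac d : (0 < d)%N -> exists2 a : R, 0 <= a <= 1 & (y %/ d)%N%:R = y%:R / d%:R - a.
  move=> d0; have D0 : 0 < d%:R :> R by rewrite ltr0n.
  exists ((y %% d)%N%:R / d%:R).
    rewrite divr_ge0 //= ler_pdivrMr // mul1r ler_nat ltnW ?ltn_mod //.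
  by rewrite {2}(divn_eq y d) natrD natrM; field; rewrite gt_eqF.
have [b b01 ->] := frac q q0; have [a a01 ->] := frac q.+1 (ltn0Sn q).
have qS : q.+1%:R = q%:R + 1 :> R by rewrite natr1.
pose w : R := y%:R / (q%:R * q.+1%:R).
have w0 : 0 <= w by rewrite divr_ge0 // mulr_ge0.
have := parabola_sum_error w0 (ltW Q0) a01 b01.
rewrite -qS.
have -> : w * (q%:R * q.+1%:R) = y%:R by rewrite /w divfK // mulf_neq0 ?gt_eqF.
have -> : w * q.+1%:R = y%:R / q%:R by rewrite /w; field; rewrite !gt_eqF.
have -> : w * q%:R = y%:R / q.+1%:R by rewrite /w; field; rewrite !gt_eqF.
have -> : w ^+ 3 * (q%:R * q.+1%:R) / 6 = y%:R ^+ 3 / 6 * (q%:R ^+ 2 * q.+1%:R ^+ 2)^-1.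
  by rewrite /w; field; rewrite !gt_eqF.
by [].
Qed.

(** Partial sums of six times the areas under the parabolas of remainder_prod, after
    scaling y to 1. *)
Definition block_area (p : nat) : R := \sum_(q < p) (q.+1%:R ^+ 2 * q.+2%:R ^+ 2)^-1.

(** The term at q is at most 1 / q^3 - 1 / (q+1)^3. *)
Lemma block_area_tail p L : (p <= L)%N ->
  0 <= block_area L - block_area p <= (p.+1%:R ^+ 3)^-1 - (L.+1%:R ^+ 3)^-1.
Proof.
move=> /subnKC <-; elim: (L - p)%N => [|l IHl]; first by rewrite addn0 !subrr lexx.
rewrite addnS /block_area big_ord_recr /= -!/(block_area _).
set m := (p + l)%N in IHl *; have M0 : 0 < m.+1%:R :> R by rewrite ltr0n.
rewrite -[m.+2%:R]natr1; move: (m.+1%:R) M0 IHl => M M0 /andP[h0 h1].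
have t0 : 0 <= (M ^+ 2 * (M + 1) ^+ 2)^-1.
  by rewrite invr_ge0 mulr_ge0 ?exprn_ge0 //; lra.
have : (M ^+ 2 * (M + 1) ^+ 2)^-1 <= (M ^+ 3)^-1 - ((M + 1) ^+ 3)^-1.
  rewrite -subr_ge0.
  have -> : (M ^+ 3)^-1 - ((M + 1) ^+ 3)^-1 - (M ^+ 2 * (M + 1) ^+ 2)^-1 =
     (2 * M ^+ 2 + 2 * M + 1) / (M ^+ 3 * (M + 1) ^+ 3).
    by field; rewrite !gt_eqF //; lra.
  by rewrite divr_ge0 ?mulr_ge0 ?exprn_ge0 ?addr_ge0 ?mulr_ge0 ?exprn_ge0 //; lra.
move: (_ * _)^-1 (M ^- 3) ((M + 1) ^- 3) (p.+1%:R ^- 3) t0 h1 => u v v' v0 t0 h1 h.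
by apply/andP; split; lra.
Qed.

Lemma remainder_sum_blocks y p :
  `|\sum_(k < y) remainder_prod y k.+1 - \sum_(k < y %/ p.+1) remainder_prod y k.+1
     - y%:R ^+ 3 / 6 * block_area p|
  <= p%:R * (y%:R + p%:R * p.+1%:R).
Proof.
elim: p => [|p IHp].
  by rewrite divn1 subrr /block_area big_ord0 mulr0 subrr normr0 mul0r.
have := remainder_block y (ltn0Sn p); rewrite /block_area big_ord_recr /= -/(block_area p).
move: IHp; set A := \sum_(k < y) _; set B := \sum_(k < _) _; set C := \sum_(k < _) _.
set z := block_area p; set z' := (_ * _)^-1 => h1 h2.
have -> : A - C - y%:R ^+ 3 / 6 * (z + z') =
    (A - B - y%:R ^+ 3 / 6 * z) + (B - C - y%:R ^+ 3 / 6 * z') by ring.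
apply: le_trans (ler_normD _ _) _; apply: le_trans (lerD h1 h2) _.
rewrite -[p.+2%:R]natr1 -[p.+1%:R]natr1.
have p0 : 0 <= p%:R :> R by []; move: (p%:R : R) p0 => P p0.
by have PP := mulr_ge0 p0 p0; nra.
Qed.

Lemma remainder_prod_le y k : 0 <= remainder_prod y k.+1 <= k.+1%:R ^+ 2.
Proof.
have rk : (y %% k.+1)%N%:R <= k.+1%:R :> R by rewrite ler_nat ltnW ?ltn_mod.
have r0 : 0 <= (y %% k.+1)%N%:R :> R by [].
rewrite /remainder_prod; move: (y %% k.+1)%N%:R (k.+1%:R) rk r0 => r K rk r0.
by apply/andP; split; nra.
Qed.

Lemma remainder_sum_le y N : 0 <= \sum_(k < N) remainder_prod y k.+1 <= N%:R ^+ 3.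
Proof.
apply/andP; split; first by apply: sumr_ge0 => k _; case/andP: (remainder_prod_le y k).
apply: (@le_trans _ _ (\sum_(k < N) N%:R ^+ 2)).
  apply: ler_sum => k _; case/andP: (remainder_prod_le y k) => _ /le_trans; apply.
  by rewrite lerXn2r ?nnegrE // ler_nat.
by rewrite sumr_const card_ord [N%:R ^+ 3]exprSr mulr_natr.
Qed.

(** The p longest blocks are compared with their areas, each with error O(y); with p close to
    the square root of y, the remaining k <= y / (p+1) contribute at most
    (y / (p+1))^3 <= y (p+1), and so does the tail of the areas.  The coefficient of
    the cube may use any number L >= p of areas. *)
Lemma riesz_sum_estimate y p L D : (p ^ 2 <= y)%N -> (y <= p.+1 ^ 2)%N -> (p <= L)%N ->
    (y <= D)%N ->
  `|(riesz_sum D y)%:R - ((1 / 4 + block_area L / 12) * y%:R ^+ 3 - y%:R ^+ 2 / 4)|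
  <= 2 * (y%:R * p.+1%:R).
Proof.
move=> le_py le_yp le_pL le_yD; rewrite (riesz_sum_remainder le_yD).
have blocks := remainder_sum_blocks y p.
have /andP[S0 SN] := remainder_sum_le y (y %/ p.+1).
have /andP[Z0 Z1] := block_area_tail le_pL.
have NQ : (y %/ p.+1)%N%:R * p.+1%:R <= y%:R :> R by rewrite -natrM ler_nat leq_divM.
have N0 : 0 <= (y %/ p.+1)%N%:R :> R by [].
have Y0 : 0 <= y%:R :> R by [].
have Q0 : 0 < p.+1%:R :> R by rewrite ltr0n.
have YQ : y%:R <= p.+1%:R ^+ 2 :> R by rewrite -natrX ler_nat.
have PY : p%:R ^+ 2 <= y%:R :> R by rewrite -natrX ler_nat.
have P0 : 0 <= p%:R :> R by [].
have PQ : p.+1%:R = p%:R + 1 :> R by rewrite natr1.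
have L0 : 0 <= (L.+1%:R ^+ 3)^-1 :> R by rewrite invr_ge0 exprn_ge0.
move: blocks S0 SN Z0 Z1 NQ N0 YQ PY.
set A := \sum_(k < y) _; set B := \sum_(k < _) _.
set zp := block_area p; set zL := block_area L.
move: (y %/ p.+1)%N%:R (y%:R) Y0 (p%:R) P0 PQ => N Y Y0 P P0.
move: p.+1%:R Q0 => Q Q0 PQ blocks S0 SN Z0 Z1 NQ N0 YQ PY.
have NleQ : N <= Q by rewrite -(ler_pM2r Q0) -expr2; apply: le_trans YQ.
have B_le : B <= Y * Q.
  apply: le_trans SN _; rewrite exprS expr2 mulrA.
  have NQ0 : N * N <= N * Q by rewrite ler_wpM2l.
  apply: ler_pM => //; [by rewrite mulr_ge0 | exact: le_trans NQ].
have err : P * (Y + P * Q) <= 2 * (Y * Q).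
  have h1 : P ^+ 2 * Q <= Y * Q by rewrite ler_wpM2r // ltW.
  have h2 : P * Y <= Q * Y by rewrite ler_wpM2r // PQ; lra.
  by rewrite expr2 in h1; lra.
have tail : Y ^+ 3 * (zL - zp) <= Y * Q.
  apply: (@le_trans _ _ (Y ^+ 3 * (Q ^+ 3)^-1)).
    by rewrite ler_wpM2l ?exprn_ge0 //; apply: le_trans Z1 _; rewrite lerBlDr lerDl.
  rewrite ler_pdivrMr ?exprn_gt0 // exprS -mulrA ler_wpM2l // -exprS.
  by rewrite (_ : Q ^+ 4 = (Q ^+ 2) ^+ 2) ?lerXn2r ?nnegrE ?exprn_ge0 ?(ltW Q0) // -exprM.
have tail0 : 0 <= Y ^+ 3 * (zL - zp) by rewrite mulr_ge0 ?exprn_ge0.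
move: blocks; rewrite !ler_norml => /andP[b1 b2].
have YQ0 : 0 <= Y * Q by rewrite mulr_ge0 // ltW.
by apply/andP; split; nra.
Qed.

Lemma square_bracket y : exists2 p, (p ^ 2 <= y)%N & (y <= p.+1 ^ 2)%N.
Proof.
elim: y => [|y [p le_py le_yp]]; first by exists 0%N.
move: le_yp; rewrite leq_eqVlt => /orP[/eqP ->|lt_yp]; last by exists p => //; lia.
by exists p.+1; [lia | nia].
Qed.

(** For p close to the square root of y, either p is at most y / s, or y is bounded
    in terms of s. *)
Lemma riesz_sum_error y L s : (y <= L)%N -> (0 < s)%N ->
  `|(riesz_sum L y)%:R - ((1 / 4 + block_area L / 12) * y%:R ^+ 3 - y%:R ^+ 2 / 4)|
  <= 2 * (y%:R ^+ 2 / s%:R + s.+2%:R ^+ 3).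
Proof.
move=> le_yL s0; have [p le_py le_yp] := square_bracket y.
have le_pL : (p <= L)%N by apply: leq_trans le_yL; nia.
apply: le_trans (riesz_sum_estimate le_py le_yp le_pL le_yL) _.
rewrite ler_pM2l //; have S0 : 0 < s%:R :> R by rewrite ltr0n.
have [le_sy|lt_ys] := leqP (s * p.+1) y.
  apply: (@le_trans _ _ (y%:R ^+ 2 / s%:R)); last by rewrite lerDl exprn_ge0.
  by rewrite ler_pdivlMr // -mulrA expr2 ler_wpM2l // -natrM mulnC ler_nat.
apply: (@le_trans _ _ (s.+2%:R ^+ 3)); last by rewrite lerDr divr_ge0 ?exprn_ge0.
have p_le : (p <= s.+1)%N by rewrite leqNgt; apply/negP => lt_sp; nia.
rewrite -natrM -natrX ler_nat.
have : (y <= s * s.+2)%N by nia.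
nia.
Qed.

End Divisors.

(** * The limit *)

Lemma catalan_gt0 (R : realFieldType) n : 0 < catalan R n.
Proof. by rewrite divr_gt0 // ltr0n bin_gt0 mul2n -addnn leq_addr. Qed.

(** The cubic term with its coefficient Z disappears, so Z may depend on n. *)
Lemma ulis_ratio_error (R : realFieldType) n s : (2 <= n)%N -> (0 < s)%N ->
  `|(ulis_avoiders n pattern132)%:R / catalan R n - 1 / 2|
  <= 600 * 320 * (s%:R^-1 + s.+2%:R ^+ 3 / n.+2%:R).
Proof.
move=> n2 s0; have n0 : (0 < n)%N by apply: ltnW.
have c0 := catalan_gt0 R n.
pose Z : R := 1 / 4 + block_area R n.+3 / 12.
pose e (y : nat) : R := (riesz_sum n.+3 y)%:R - (Z * y%:R ^+ 3 - y%:R ^+ 2 / 4).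
have uE : (ulis_avoiders n pattern132)%:R =
    catalan R n / 2 + \sum_(y < n.+3) e y * (diff_kernel R n)`_(n.+2 - y).
  rewrite (ulis_avoiders_sum R n0).
  have -> : catalan R n / 2 =
      Z * \sum_(y < n.+3) (y ^ 3)%N%:R * (diff_kernel R n)`_(n.+2 - y)
      - 1 / 4 * \sum_(y < n.+3) (y ^ 2)%N%:R * (diff_kernel R n)`_(n.+2 - y).
    by rewrite sum_cube_kernel // sum_sqr_kernel //; field.
  rewrite !mulr_sumr -sumrB -big_split; apply: eq_bigr => y _ /=.
  by rewrite /e !natrX; field.
have S0 : 0 < s%:R :> R by rewrite ltr0n.
have N0 : 0 < n.+2%:R :> R by rewrite ltr0n.
have err : `|\sum_(y < n.+3) e y * (diff_kernel R n)`_(n.+2 - y)| <=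
    2 * (300 * 320 * catalan R n / s%:R + s.+2%:R ^+ 3 * (300 * 320 * catalan R n / n.+2%:R)).
  apply: le_trans (ler_norm_sum _ _ _) _.
  apply: (@le_trans _ _ (2 * ((\sum_(y < n.+3) y%:R ^+ 2 * `|(diff_kernel R n)`_(n.+2 - y)|) / s%:R
      + s.+2%:R ^+ 3 * \sum_(y < n.+3) `|(diff_kernel R n)`_(n.+2 - y)|))).
    rewrite mulr_suml mulr_sumr -big_split mulr_sumr; apply: ler_sum => y _ /=.
    rewrite normrM.
    have le_yN : (y <= n.+3)%N by apply: ltnW.
    apply: le_trans (ler_wpM2r (normr_ge0 _) (riesz_sum_error R le_yN s0)) _.
    by apply: le_of_eq; field; rewrite gt_eqF.
  rewrite ler_pM2l // lerD //.
    by rewrite ler_pM2r ?invr_gt0 // kernel_sqr_sum.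
  by rewrite ler_wpM2l ?exprn_ge0 // ler_pdivlMr // kernel_sum.
have -> : (ulis_avoiders n pattern132)%:R / catalan R n - 1 / 2 =
    (\sum_(y < n.+3) e y * (diff_kernel R n)`_(n.+2 - y)) / catalan R n.
  by rewrite uE; field; rewrite gt_eqF.
rewrite normrM normfV (gtr0_norm c0) ler_pdivrMr //; apply: le_trans err _.
by apply: le_of_eq; field; rewrite !gt_eqF.
Qed.

Local Open Scope classical_set_scope.
Local Open Scope ring_scope.

Theorem corollary3p2 (R : realType) :
  (ulis_avoiders n pattern132)%:R / catalan R n @[n --> \oo] --> (1 / 2 : R).
Proof.
apply/cvgrPdist_le => /= eps eps0.
have [C CE C0] : exists2 C : R, C = 600 * 320 & 0 < C by exists (600 * 320); [reflexivity | lra].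
(* First s makes C / (s + 1) small, then n makes the other term small. *)
have [s s_gt] : exists s : nat, 2 * C / eps < s.+1%:R :> R.
  exists (Num.truncn (2 * C / eps)); exact: truncnS_gt.
pose B : R := 2 * C * s.+3%:R ^+ 3 / eps.
exists (Num.truncn B).+2 => // n /= le_Bn.
have n2 : (2 <= n)%N by apply: leq_trans le_Bn.
rewrite distrC; apply: le_trans (ulis_ratio_error R n2 (ltn0Sn s)) _.
have S0 : 0 < s.+1%:R :> R by rewrite ltr0n.
have N0 : 0 < n.+2%:R :> R by rewrite ltr0n.
have h1 : C * s.+1%:R^-1 <= eps / 2.
  by rewrite ler_pdivrMr //; move: s_gt; rewrite ltr_pdivrMr //; lra.
have h2 : C * (s.+3%:R ^+ 3 / n.+2%:R) <= eps / 2.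
  have : B < n.+2%:R.
    apply: lt_le_trans (truncnS_gt _) _; rewrite ler_nat.
    by apply: leq_trans (leq_trans le_Bn _) => //; rewrite -addn2 leq_addr.
  rewrite /B ltr_pdivrMr // [C * (_ / _)]mulrA ler_pdivrMr //.
  by move: (s.+3%:R ^+ 3 : R) => X; lra.
by rewrite -CE mulrDr; apply: le_trans (lerD h1 h2) _; lra.
Qed.
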